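(* Let $1\le s<n-1$, $T=\{1,\dots,s\}$, $S=\{s+1,\dots,2n\}$, and let $so(2n,\mathbb C)$ act on $\mathcal A=\mathbb C[x_1,\dots,x_{2n}]$ by the representation attached to $(S,T)$ described in the context. Let $$\Delta=\sum_{j=s+1}^n\partial_{x_j}\partial_{x_{n+j}}-\sum_{i=1}^sx_i\partial_{x_{n+i}},\qquad\eta=\sum_{j=s+1}^nx_jx_{n+j}+\sum_{i=1}^sx_{n+i}\partial_{x_i},$$ and $\mathcal H_{\langle k\rangle}=\{f\in\mathcal A_{\langle k\rangle}\mid\Delta(f)=0\}$. If $k\le-(n-s-1)$, then $\mathcal A_{\langle k\rangle}=\mathcal H_{\langle k\rangle}\oplus\eta\mathcal A_{\langle k-2\rangle}$, and $\mathcal H_{\langle k\rangle}$ is an irreducible highest weight module with highest weight $-k\lambda_{s-1}+(k-1)\lambda_s$ and a corresponding highest weight vector $x_s^{-k}$. Moreover, the set of polynomials $$\sum_{r_1,\dots,r_{n-1}=0}^\infty\frac{(-1)^{\sum_{j=s+1}^{n-1}r_j}\,\alpha_n!\,\alpha_{2n}!\,\prod_{j=s+1}^{n-1}\binom{\alpha_j}{r_j}\prod_{i=1}^{n-1}\binom{\alpha_{n+i}}{r_i}\,(r_1+\cdots+r_{n-1})!\,\prod_{j=s+1}^{n-1}r_j!}{(\alpha_n+r_1+\cdots+r_{n-1})!\,(\alpha_{2n}+r_1+\cdots+r_{n-1})!}$$ $$\times\prod_{i=1}^sx_i^{\alpha_i+r_i}\prod_{j=s+1}^{n-1}x_j^{\alpha_j-r_j}\prod_{i=1}^{n-1}x_{n+i}^{\alpha_{n+i}-r_i}\;x_n^{\alpha_n+r_1+\cdots+r_{n-1}}x_{2n}^{\alpha_{2n}+r_1+\cdots+r_{n-1}},$$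 where $\alpha_1,\dots,\alpha_{2n}\in\mathbb N$ satisfy $\alpha_n\alpha_{2n}=0$ and $\sum_{j=s+1}^n\alpha_j+\sum_{i=1}^n\alpha_{n+i}-\sum_{i=1}^s\alpha_i=k$, forms a basis of $\mathcal H_{\langle k\rangle}$.
   Context: $\mathbb N$ denotes the nonnegative integers; $E_{i,j}$ are matrix units of size $2n$; $\binom{a}{r}=0$ for $r>a$. $$\mathcal G=so(2n,\mathbb C)=\sum_{i,j=1}^n\mathbb C(E_{i,j}-E_{n+j,n+i})+\sum_{1\le i<j\le n}[\mathbb C(E_{i,n+j}-E_{j,n+i})+\mathbb C(E_{n+j,i}-E_{n+i,j})].$$ Cartan subalgebra $H=\sum_{i=1}^n\mathbb C(E_{i,i}-E_{n+i,n+i})$; positive root vectors $E_{i,j}-E_{n+j,n+i}$, $E_{i,n+j}-E_{j,n+i}$ ($1\le i<j\le n$), spanning $\mathcal G_+$. With $h_i=E_{i,i}-E_{n+i,n+i}-E_{i+1,i+1}+E_{n+i+1,n+i+1}$ ($1\le i\le n-1$) and $h_n=E_{n-1,n-1}-E_{2n-1,2n-1}+E_{n,n}-E_{2n,2n}$, the fundamental weights $\lambda_1,\dots,\lambda_n\in H^*$ satisfy $\lambda_i(h_j)=\delta_{i,j}$; $\lambda_0=0$. The representation attached to a partition $(S,T)$ of $\{1,\dots,2n\}$ is the restriction to $\mathcal G$ of the representation of $gl(2n,\mathbb C)$ on $\mathcal A$: $E_{i,j}=x_i\partial_{x_j}$ if $i,j\in S$; $-x_ix_j$ if $i\in S,j\in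 T$; $\partial_{x_i}\partial_{x_j}$ if $i\in T,j\in S$; $-x_j\partial_{x_i}-\delta_{i,j}$ if $i,j\in T$. $\mathcal A_{\langle k\rangle}=\mathrm{Span}\{x^\alpha\mid\alpha\in\mathbb N^{2n},\sum_{i\in S}\alpha_i-\sum_{i\in T}\alpha_i=k\}$. The operators $\Delta,\eta$ commute with $\mathcal G$. A highest weight module is one generated by a nonzero $v$ with $H.v\subset\mathbb Cv$ and $\mathcal G_+.v=0$ (a highest weight vector), whose weight is the highest weight. *)

(* Defs.v *)
From HB Require Import structures.
From mathcomp Require Import all_boot all_order all_algebra.
From mathcomp Require Import classical_sets cardinality fsbigop reals.
From mathcomp Require Import complex.
From mathcomp Require Import mpoly.

(* The complex numbers are R[i] for R : realType. *)

Set Implicit Arguments.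
Unset Strict Implicit.
Unset Printing Implicit Defensive.

Import Order.TTheory GRing.Theory Num.Theory.

Local Open Scope ring_scope.

(* Subspaces of a possibly infinite-dimensional space V are predicates. *)
Section LinearAlgebra.
Variables (K : fieldType) (V : lmodType K).

Definition in_span (P : V -> Prop) (v : V) : Prop :=
  exists2 r : seq (K * V),
    (forall p, p \in r -> P p.2) & v = \sum_(p <- r) p.1 *: p.2.

Definition is_direct_sum (U W1 W2 : V -> Prop) : Prop :=
  (forall u, U u <-> exists w1 w2, [/\ W1 w1, W2 w2 & u = w1 + w2]) /\
  (forall w, W1 w -> W2 w -> w = 0).

(* The family (b i), for i satisfying P, is a basis of U. *)
Definition is_basis_of (I : eqType) (P : I -> Prop) (b : I -> V)
    (U : V -> Prop) : Prop :=
  (forall (r : seq I) (c : I -> K),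
     uniq r -> (forall i, i \in r -> P i) ->
     \sum_(i <- r) c i *: b i = 0 -> forall i, i \in r -> c i = 0) /\
  (forall u, U u <-> in_span (fun v => exists2 i, P i & v = b i) u).

End LinearAlgebra.

(* g (with h, gp its Cartan and positive parts) is a subspace of L, and only
   the restriction to g of the action act is used. *)
Section Modules.
Variables (K : fieldType) (L : vectType K) (V : lmodType K).
Variables (act : L -> V -> V) (g h gp : {vspace L}).

Definition is_submodule (U : V -> Prop) : Prop :=
  [/\ U 0,
      forall u v, U u -> U v -> U (u + v),
      forall (a : K) u, U u -> U (a *: u) &
      forall X u, X \in g -> U u -> U (act X u)].

Definition irreducible_module (U : V -> Prop) : Prop :=
  [/\ is_submodule U,
      exists2 u, U u & u != 0 &
      forall W : V -> Prop, is_submodule W -> (forall w, W w -> U w) ->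
        (forall w, W w -> w = 0) \/ (forall u, U u -> W u)].

Definition highest_weight_vector (mu : L -> K) (v : V) : Prop :=
  [/\ v != 0,
      forall X, X \in h -> act X v = mu X *: v &
      forall X, X \in gp -> act X v = 0].

Definition highest_weight_module (mu : L -> K) (v : V) (U : V -> Prop)
    : Prop :=
  [/\ is_submodule U, U v, highest_weight_vector mu v &
      forall W : V -> Prop, is_submodule W -> W v -> forall u, U u -> W u].

End Modules.

(* Indices are 0-based: for i : 'I_n, lshift n i : 'I_(n + n) stands for i + 1
   and rshift n i : 'I_(n + n) stands for n + (i + 1). *)
Section EvenOrthogonal.
Variables (K : fieldType) (n : nat).

Local Notation E := (delta_mx : 'I_(n + n) -> 'I_(n + n) -> 'M[K]_(n + n)).
Local Notation lo := (lshift n).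
Local Notation hi := (@rshift n n).

Definition so_even : {vspace 'M[K]_(n + n)} :=
  (\sum_(i < n) \sum_(j < n) <[E (lo i) (lo j) - E (hi j) (hi i)]> +
   \sum_(i < n) \sum_(j < n | (i < j)%N)
     (<[E (lo i) (hi j) - E (lo j) (hi i)]> +
      <[E (hi j) (lo i) - E (hi i) (lo j)]>))%VS.

Definition cartan_gen (i : 'I_n) : 'M[K]_(n + n) :=
  E (lo i) (lo i) - E (hi i) (hi i).

Definition cartan : {vspace 'M[K]_(n + n)} :=
  (\sum_(i < n) <[cartan_gen i]>)%VS.

Definition so_even_pos : {vspace 'M[K]_(n + n)} :=
  (\sum_(i < n) \sum_(j < n | (i < j)%N)
     (<[E (lo i) (lo j) - E (hi j) (hi i)]> +
      <[E (lo i) (hi j) - E (lo j) (hi i)]>))%VS.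

End EvenOrthogonal.

(* Here the rank is n = m + 1, so that ord_max : 'I_n is the index n. *)
Section FundamentalWeights.
Variables (K : fieldType) (m : nat).
Local Notation n := m.+1.

Definition coroot (i : 'I_n) : 'M[K]_(n + n) :=
  if (i < m)%N then cartan_gen K i - cartan_gen K (inord i.+1)
  else cartan_gen K (inord m.-1) + cartan_gen K ord_max.

(* fund_weight i is lambda_i for i <= n: the basis of the dual of the Cartan
   subalgebra that is dual to the coroots, with lambda_0 = 0; only its values
   on the Cartan subalgebra are meaningful (see fund_weight_coroot). *)
Definition fund_weight (i : nat) (X : 'M[K]_(n + n)) : K :=
  if i is i'.+1 then coord [tuple coroot j | j < n] (inord i') X else 0.

End FundamentalWeights.

Section Oscillator.
Variables (K : fieldType) (N : nat) (S : {set 'I_N}).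

(* The action of the matrix unit E_{i,j}; the complement of S is T. *)
Definition osc_unit (i j : 'I_N) (f : {mpoly K[N]}) : {mpoly K[N]} :=
  match i \in S, j \in S with
  | true, true => 'X_i * mderiv j f
  | true, false => - ('X_i * 'X_j * f)
  | false, true => mderiv i (mderiv j f)
  | false, false => - ('X_j * mderiv i f) - (i == j)%:R *: f
  end.

Definition osc_rep (M : 'M[K]_N) (f : {mpoly K[N]}) : {mpoly K[N]} :=
  \sum_(i < N) \sum_(j < N) M i j *: osc_unit i j f.

Definition osc_deg (a : 'X_{1..N}) : int :=
  \sum_(i in S) (a i)%:Z - \sum_(i in ~: S) (a i)%:Z.

Definition graded_part (k : int) : {mpoly K[N]} -> Prop :=
  in_span (fun f => exists2 a : 'X_{1..N}, osc_deg a = k & f = 'X_[a]).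

End Oscillator.

Section Harmonic.
Variables (K : fieldType) (n s : nat).
Local Notation lo := (lshift n).
Local Notation hi := (@rshift n n).

(* S = {s + 1, ..., 2n}, and hence T = {1, ..., s}. *)
Definition osc_S : {set 'I_(n + n)} := [set i : 'I_(n + n) | (s <= i)%N].

Definition osc_Delta (f : {mpoly K[n + n]}) : {mpoly K[n + n]} :=
  \sum_(j < n | (s <= j)%N) mderiv (lo j) (mderiv (hi j) f)
  - \sum_(i < n | (i < s)%N) 'X_(lo i) * mderiv (hi i) f.

Definition osc_eta (f : {mpoly K[n + n]}) : {mpoly K[n + n]} :=
  \sum_(j < n | (s <= j)%N) 'X_(lo j) * 'X_(hi j) * f
  + \sum_(i < n | (i < s)%N) 'X_(hi i) * mderiv (lo i) f.

Definition harmonic_part (k : int) (f : {mpoly K[n + n]}) : Prop :=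
  graded_part osc_S k f /\ osc_Delta f = 0.

End Harmonic.

(* The rank is n = m + 1 again, and r is indexed by {1, ..., n - 1}. *)
Section HarmonicBasis.
Variables (K : fieldType) (m s : nat).
Local Notation n := m.+1.
Local Notation lo := (lshift n).
Local Notation hi := (@rshift n n).
Local Notation w := (widen_ord (leqnSn m)).

Definition basis_index (k : int) (a : 'X_{1..n + n}) : Prop :=
  (a (lo ord_max) * a (hi ord_max) = 0)%N /\
  \sum_(j < n | (s <= j)%N) (a (lo j))%:Z + \sum_(i < n) (a (hi i))%:Z
  - \sum_(i < n | (i < s)%N) (a (lo i))%:Z = k.

Definition basis_coef (a : 'X_{1..n + n}) (r : {ffun 'I_m -> nat}) : K :=
  let rs := (\sum_(i < m) r i)%N in
  (-1) ^+ (\sum_(j < m | (s <= j)%N) r j)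
  * ((a (lo ord_max))`! * (a (hi ord_max))`!
     * (\prod_(j < m | (s <= j)%N) 'C(a (lo (w j)), r j))
     * (\prod_(i < m) 'C(a (hi (w i)), r i))
     * rs`! * \prod_(j < m | (s <= j)%N) (r j)`!)%:R
  / ((a (lo ord_max) + rs)`! * (a (hi ord_max) + rs)`!)%:R.

(* A truncated exponent (alpha < r) only occurs where basis_coef is 0. *)
Definition basis_monom (a : 'X_{1..n + n}) (r : {ffun 'I_m -> nat})
    : {mpoly K[n + n]} :=
  let rs := (\sum_(i < m) r i)%N in
  (\prod_(i < m | (i < s)%N) 'X_(lo (w i)) ^+ (a (lo (w i)) + r i))
  * (\prod_(j < m | (s <= j)%N) 'X_(lo (w j)) ^+ (a (lo (w j)) - r j))
  * (\prod_(i < m) 'X_(hi (w i)) ^+ (a (hi (w i)) - r i))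
  * 'X_(lo ord_max) ^+ (a (lo ord_max) + rs)
  * 'X_(hi ord_max) ^+ (a (hi ord_max) + rs).

(* fsbigop sums have the value 0 when the support is infinite; that never
   happens here (see finite_basis_support). *)
Definition basis_poly (a : 'X_{1..n + n}) : {mpoly K[n + n]} :=
  \sum_(r \in [set: {ffun 'I_m -> nat}]) (basis_coef a r *: basis_monom a r).

Lemma basis_coef_eq0 (a : 'X_{1..n + n}) (r : {ffun 'I_m -> nat}) (i : 'I_m) :
  (a (hi (w i)) < r i)%N -> basis_coef a r = 0.
Proof.
move=> lt_ar; rewrite /basis_coef.
rewrite [X in (_ * X * _ * _)%N](bigD1 i) //= bin_small //.
by rewrite mul0n !(muln0, mul0n) mulr0 mul0r.
Qed.

Lemma finite_basis_support (a : 'X_{1..n + n}) :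
  finite_set [set r | basis_coef a r *: basis_monom a r != 0].
Proof.
pose B := (\sum_(i < m) a (hi (w i))).+1.
pose F (q : {ffun 'I_m -> 'I_B}) : {ffun 'I_m -> nat} := [ffun i => q i : nat].
have finF : finite_set [set F q | q in [set: {ffun 'I_m -> 'I_B}]].
  exact/finite_image/finite_finset.
apply: sub_finite_set finF => r /= nz; exists [ffun i => inord (r i)] => //.
apply/ffunP => i; rewrite !ffunE inordK // ltnS.
have le_ra : (r i <= a (hi (w i)))%N.
  rewrite leqNgt; apply/negP => /basis_coef_eq0 z.
  by rewrite z scale0r eqxx in nz.
by apply: leq_trans le_ra _; rewrite (bigD1 i) //= leq_addr.
Qed.

End HarmonicBasis.

Section FundamentalWeightsTheory.
Variables (K : numFieldType) (m : nat).
Local Notation n := m.+1.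

Lemma cartan_gen_lo (i j : 'I_n) :
  cartan_gen K i (lshift n j) (lshift n j) = (i == j)%:R.
Proof.
rewrite /cartan_gen !mxE eq_lshift eq_lrshift subr0 andbb.
by rewrite eq_sym.
Qed.

Lemma coroot_free : (0 < m)%N -> free [tuple coroot K j | j < n].
Proof.
move=> m_gt0; apply/freeP => c c0.
pose d (i : nat) : K := c (inord i).
have cE (i : 'I_n) : c i = d i by rewrite /d inord_val.
have delta b a : \sum_(i < b) d i * (i == a :> nat)%:R = (a < b)%:R * d a.
  elim: b => [|b IH]; first by rewrite big_ord0 mul0r.
  rewrite big_ord_recr /= IH [(a < b.+1)%N]ltnS [(a <= b)%N]leq_eqVlt [b == a]eq_sym.
  by case: (a =P b) => [->|_]; rewrite ?ltnn /= ?mulr0 ?mulr1 ?mul0r ?mul1r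
    ?add0r ?addr0.
have {}c0 : \sum_(i < n) c i *: coroot K i = 0.
  rewrite -[RHS]c0; apply: eq_bigr => i _.
  by rewrite (nth_map i) ?size_enum_ord // nth_ord_enum.
have {}c0 a : (a <= m)%N ->
    (a < m)%:R * d a - (0 < a)%:R * d a.-1
    + ((m.-1 == a)%:R + (m == a)%:R) * d m = 0.
  move=> le_am; set a' : 'I_n := inord a.
  have := congr1 (fun M : 'M[K]_(n + n) => M (lshift n a') (lshift n a')) c0.
  rewrite summxE mxE => e; rewrite -[RHS]e.
  rewrite big_ord_recr /= mxE {2}/coroot ltnn mxE !cartan_gen_lo -!val_eqE /= !inordK //; last first.
    by case: (m) m_gt0 => //= p _; rewrite ltnW.
  rewrite cE /= [_ * d m]mulrC; congr (_ + _).
  transitivity (\sum_(i < m) (d i * (i == a :> nat)%:R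
      - d i * (i.+1 == a)%:R)).
    rewrite sumrB delta; congr (_ - _); case: a le_am {a' e} => [|a] le_am.
      by rewrite mul0r big1 // => i _; rewrite mulr0.
    rewrite mul1r /=; under eq_bigr => i _ do rewrite eqSS.
    by rewrite delta le_am mul1r.
  apply: eq_bigr => i _; set i' := widen_ord _ i.
  rewrite mxE /coroot.
  rewrite /= ltn_ord !mxE cE /=.
  rewrite -mulrBr; congr (_ * _).
  have := cartan_gen_lo i' a'; have := cartan_gen_lo (inord i'.+1) a'.
  rewrite !mxE => -> ->.
  by rewrite -!val_eqE /= !inordK // ltnS ltn_ord.
have d0 a : (a < m.-1)%N -> d a = 0.
  elim: a => [|a IH] lt_a.
    have := c0 0%N isT; rewrite m_gt0 mul1r mul0r subr0.
    by rewrite !gtn_eqF // add0r mul0r addr0.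
  have lt_am : (a.+1 < m)%N by rewrite (leq_trans lt_a) ?leq_pred.
  have := c0 a.+1 (ltnW lt_am); rewrite lt_am mul1r /= IH ?(ltnW lt_a) //.
  by rewrite mulr0 subr0 !gtn_eqF // add0r mul0r addr0.
have e1 : d m.-1 + d m = 0.
  have := c0 m.-1 (leq_pred m); rewrite eqxx prednK // leqnn mul1r.
  rewrite gtn_eqF ?prednK // addr0 mul1r.
  case: (m) m_gt0 d0 => // -[|p] _ d0; first by rewrite mul0r subr0.
  by rewrite /= (d0 p) // mulr0 subr0.
have e2 : d m = d m.-1.
  have := c0 m (leqnn m); rewrite ltnn m_gt0 eqxx mul0r sub0r mul1r.
  rewrite ltn_eqF ?prednK // add0r mul1r => /eqP.
  by rewrite addrC subr_eq0 => /eqP.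
have dm1 : d m.-1 = 0.
  have := mulrn_eq0 (d m.-1) 2; rewrite mulr2n -{2}e2 e1 eqxx /=.
  by move/esym/eqP.
move=> i; rewrite cE; have := ltn_ord i; rewrite ltnS leq_eqVlt.
case/predU1P => [->|]; first by rewrite e2.
rewrite -[X in (_ < X)%N](prednK m_gt0) ltnS leq_eqVlt.
by case/predU1P => [->|/d0].
Qed.

(* The coroots and the fundamental weights are dual to each other. *)
Lemma fund_weight_coroot (i : nat) (j : 'I_n) :
  (0 < m)%N -> (0 < i <= n)%N ->
  fund_weight i (coroot K j) = (i == j.+1)%:R.
Proof.
case: i => // i m_gt0 /= lt_in.
have := coord_free j (inord i) (coroot_free m_gt0).
rewrite (nth_map j) ?size_enum_ord // nth_ord_enum => ->.
by rewrite -val_eqE /= inordK // eqSS eq_sym.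
Qed.

End FundamentalWeightsTheory.

(* Main.v *)
Require Import Defs.
From HB Require Import structures.
From mathcomp Require Import all_boot all_order all_algebra.
From mathcomp Require Import classical_sets cardinality fsbigop reals.
From mathcomp Require Import complex.
From mathcomp Require Import mpoly.
From mathcomp Require Import ring zify.

Set Implicit Arguments.
Unset Strict Implicit.
Unset Printing Implicit Defensive.

Import Order.TTheory GRing.Theory Num.Theory.
Local Open Scope ring_scope.

(* Writing the action of E_{i,j} as Q_i P_j with canonical pairs (Q_i, P_i)
   makes Delta = sum_c P_c P_{c'} and eta = sum_c Q_c Q_{c'}, where c' = n + c;
   both commute with so(2n), and [Delta, eta] is a scalar on each A_<k>.

   Decomposition: Delta is locally nilpotent, and eta Delta + c is invertible
   for c < 0 in low degrees, so Delta (f - eta g) = 0 has a unique solution g.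

   Irreducibility: filter A by a cocharacter that is negative on T.  If f in
   H_<k> is killed by the root vectors that lower it, then for l <= s each of
   two diagonal operators kills P_{n+l} f; the sum of their eigenvalues is
   negative in degree k - 1, so P_{n+l} f = 0, which forces f to be a multiple
   of x_s^-k.  The transposed computation shows, by induction on the
   filtration, that x_s^-k generates A_<k> modulo the image of eta.

   Basis: f in ker Delta is determined by its coefficients at the monomials
   with alpha_n alpha_2n = 0.  The given polynomials have there the coefficients
   of x^alpha, and they are killed by Delta because the r-th term under
   d_{x_i} d_{x_{n+i}} (or -x_i d_{x_{n+i}}) cancels the share
   (r_i + 1) / (|r| + 1) of the (r + e_i)-th term under d_{x_n} d_{x_2n}. *)

(** * Oscillator operators and the grading *)

Section WeylOperators.
Variables (K : fieldType) (N : nat) (S : {set 'I_N}).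
Implicit Types (i j : 'I_N) (f g : {mpoly K[N]}) (a : 'X_{1..N}).

(* The matrix unit E_{i,j} acts as Q_i P_j, where the Q_i and the P_j satisfy
   the canonical commutation relations [P_i, Q_j] = delta_{i,j}. *)
Definition oscQ i f := if i \in S then 'X_i * f else mderiv i f.
Definition oscP i f := if i \in S then mderiv i f else - ('X_i * f).

Fact oscQ_is_linear i : linear (oscQ i).
Proof.
move=> c f g; rewrite /oscQ; case: ifP => _; last by rewrite linearP.
by rewrite mulrDr scalerAr.
Qed.
HB.instance Definition _ i := GRing.isLinear.Build K {mpoly K[N]} {mpoly K[N]}
  *:%R (oscQ i) (oscQ_is_linear i).

Fact oscP_is_linear i : linear (oscP i).
Proof.
move=> c f g; rewrite /oscP; case: ifP => _; first by rewrite linearP.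
by rewrite mulrDr opprD scalerN scalerAr.
Qed.
HB.instance Definition _ i := GRing.isLinear.Build K {mpoly K[N]} {mpoly K[N]}
  *:%R (oscP i) (oscP_is_linear i).

Lemma mderivXM i j f :
  mderiv i ('X_j * f) = 'X_j * mderiv i f + (i == j)%:R *: f.
Proof.
rewrite mderivM mderivX mnm1E addrC eq_sym; congr (_ + _).
case: (i =P j) => [->|_]; last by rewrite !scale0r mul0r.
have -> : (U_(j) - U_(j) = 0)%MM by apply/mnmP => l; rewrite mnmBE subnn mnm0E.
by rewrite mpolyX0 !scale1r mul1r.
Qed.

Lemma oscQC i j f : oscQ i (oscQ j f) = oscQ j (oscQ i f).
Proof.
rewrite /oscQ; case: (boolP (i \in S)) (boolP (j \in S)) => [iS|iS] [jS|jS].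
- by rewrite mulrCA.
- by rewrite mderivXM; case: eqP jS => [->|_ _]; rewrite ?iS // scale0r addr0.
- by rewrite mderivXM; case: eqP iS => [->|_ _]; rewrite ?jS // scale0r addr0.
- by rewrite mderiv_comm.
Qed.

Lemma oscPC i j f : oscP i (oscP j f) = oscP j (oscP i f).
Proof.
rewrite /oscP; case: (boolP (i \in S)) (boolP (j \in S)) => [iS|iS] [jS|jS].
- by rewrite mderiv_comm.
- rewrite mderivN mderivXM; case: eqP jS => [<-|_ _]; rewrite ?iS //.
  by rewrite scale0r addr0.
- rewrite mderivN mderivXM; case: eqP iS => [<-|_ _]; rewrite ?jS //.
  by rewrite scale0r addr0.
- by rewrite !mulrN !opprK mulrCA.
Qed.

Lemma oscPQ i j f : oscP i (oscQ j f) = oscQ j (oscP i f) + (i == j)%:R *: f.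
Proof.
rewrite /oscQ /oscP.
case: (boolP (i \in S)) (boolP (j \in S)) => [iS|iS] [jS|jS].
- exact: mderivXM.
- rewrite mderiv_comm; case: eqP jS => [<-|_ _]; rewrite ?iS //.
  by rewrite scale0r addr0.
- rewrite mulrN mulrCA; case: eqP iS => [->|_ _]; rewrite ?jS //.
  by rewrite scale0r addr0.
- by rewrite mderivN mderivXM opprD eq_sym subrK.
Qed.

Lemma osc_unitE i j f : osc_unit S i j f = oscQ i (oscP j f).
Proof.
rewrite /osc_unit /oscQ /oscP; case: (i \in S) (j \in S) => [] [] //.
  by rewrite mulrN mulrA.
by rewrite mderivN mderivXM opprD.
Qed.

Lemma osc_rep_delta i j f : osc_rep S (delta_mx i j) f = oscQ i (oscP j f).
Proof.
rewrite /osc_rep (bigD1 i) //= (bigD1 j) //= mxE !eqxx scale1r osc_unitE.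
rewrite !big1 ?addr0 // => [i' /negPf ne|j' /negPf ne].
  by rewrite big1 // => j' _; rewrite mxE ne scale0r.
by rewrite mxE eqxx ne scale0r.
Qed.

Fact osc_rep_linearl f : linear (fun M : 'M[K]_N => osc_rep S M f).
Proof.
move=> c M M'; rewrite /osc_rep scaler_sumr -big_split; apply: eq_bigr => i _.
rewrite scaler_sumr -big_split; apply: eq_bigr => j _ /=.
by rewrite !mxE scalerDl scalerA.
Qed.

Fact osc_rep_linear (M : 'M[K]_N) : linear (osc_rep S M).
Proof.
move=> c f g; rewrite /osc_rep scaler_sumr -big_split; apply: eq_bigr => i _.
rewrite scaler_sumr -big_split; apply: eq_bigr => j _ /=.
rewrite !osc_unitE [oscP j _]linearP [oscQ i _]linearP scalerDr !scalerA.
by rewrite mulrC.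
Qed.

HB.instance Definition _ M := GRing.isLinear.Build K {mpoly K[N]} {mpoly K[N]}
  *:%R (osc_rep S M) (osc_rep_linear M).

Definition osc_rep_at f (M : 'M[K]_N) := osc_rep S M f.

HB.instance Definition _ f := GRing.isLinear.Build K 'M[K]_N {mpoly K[N]}
  *:%R (osc_rep_at f) (osc_rep_linearl f).

Lemma mcoeff_XM i f a :
  ('X_i * f)@_a = if a i == 0%N then 0 else f@_(a - U_(i)).
Proof.
case: eqP => [ai0|ai].
  apply/eqP; rewrite mcoeff_eq0; apply/negP => /msuppM_le/allpairsP[[b c]] /=.
  rewrite msuppX inE => -[/eqP -> _ /(congr1 (fun z : 'X_{1..N} => z i))].
  by rewrite mnmDE mnm1E eqxx ai0.
have {1}-> : a = (U_(i) + (a - U_(i)))%MM.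
  apply/mnmP => j; rewrite mnmDE mnmBE mnm1E; case: eqP => [<-|_] /=.
    by rewrite subnKC // lt0n; apply/eqP.
  by rewrite subn0.
by rewrite mulrC mcoeffMX.
Qed.

Lemma mcoeff_XD i f a : ('X_i * mderiv i f)@_a = (a i)%:R * f@_a.
Proof.
rewrite mcoeff_XM; case: eqP => [->|/eqP ai]; first by rewrite mul0r.
have ea : (a - U_(i) + U_(i))%MM = a.
  apply: submK; apply/mnm_lepP => j; rewrite mnm1E; case: eqP => [<-|] //=.
  by rewrite lt0n.
rewrite mcoeff_deriv ea mnmBE mnm1E eqxx subn1 prednK ?lt0n //.
by rewrite mulr_natl.
Qed.

(** Each $P_iQ_i$ is diagonal on monomials, whether [i] lies in [S] or in [T]; the scalar
    $[\Delta,\eta]$ and the eigenvalues [diag_eig] are sums of such terms. *)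
Lemma oscPQ_diag i f a :
  (oscP i (oscQ i f))@_a = (if i \in S then (a i).+1%:R else - (a i)%:R) * f@_a.
Proof.
rewrite /oscP /oscQ; case: (i \in S).
  rewrite mderivXM eqxx scale1r mcoeffD mcoeff_XD -addn1 natrD mulrDl.
  by rewrite mul1r.
by rewrite mcoeffN mcoeff_XD mulNr.
Qed.

(** A polynomial is the sum of its monomials, so the span can be traded for a condition on the
    support, which is how degrees are handled from here on. *)
Lemma graded_partP (k : int) f :
  graded_part S k f <-> forall a, f@_a != 0 -> osc_deg S a = k.
Proof.
split=> [[r rP ->] a|fk].
  apply: contra_neq_eq => ak; rewrite raddf_sum big_seq big1 //= => p pr.
  have [b bk ->] := rP p pr; rewrite mcoeffZ mcoeffX.
  by case: (b =P a) ak => [<-|_ _]; rewrite ?mulr0 // bk eqxx.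
exists [seq (f@_a, 'X_[a]) | a <- msupp f]; last first.
  by rewrite big_map /= -mpolyE.
move=> p /mapP[a]; rewrite mcoeff_msupp => /fk ak -> /=; by exists a.
Qed.

Lemma graded_part0 k : graded_part S k (0 : {mpoly K[N]}).
Proof. by apply/graded_partP => a; rewrite mcoeff0 eqxx. Qed.

Lemma graded_partD k f g :
  graded_part S k f -> graded_part S k g -> graded_part S k (f + g).
Proof.
move=> /graded_partP fk /graded_partP gk; apply/graded_partP => a.
rewrite mcoeffD; have [f0|/fk //] := eqVneq f@_a 0.
by rewrite f0 add0r => /gk.
Qed.

Lemma graded_partZ k c f : graded_part S k f -> graded_part S k (c *: f).
Proof.
move=> /graded_partP fk; apply/graded_partP => a.
by rewrite mcoeffZ mulf_eq0 negb_or => /andP[_ /fk].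
Qed.

Lemma graded_partN k f : graded_part S k f -> graded_part S k (- f).
Proof. by rewrite -scaleN1r; apply: graded_partZ. Qed.

Lemma graded_part_sum k (I : Type) (r : seq I) (A : pred I) (F : I -> {mpoly
  K[N]}) :
  (forall x, A x -> graded_part S k (F x)) ->
  graded_part S k (\sum_(x <- r | A x) F x).
Proof.
move=> Fk; elim/big_ind: _ => //; first exact: graded_part0.
exact: graded_partD.
Qed.

Lemma osc_degD a b : osc_deg S (a + b)%MM = osc_deg S a + osc_deg S b.
Proof.
rewrite /osc_deg; under eq_bigr do rewrite mnmDE PoszD.
under [X in _ - X]eq_bigr do rewrite mnmDE PoszD.
by rewrite !big_split /=; ring.
Qed.

Lemma osc_degMn a c : osc_deg S (a *+ c)%MM = osc_deg S a *+ c.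
Proof.
elim: c => [|c IH]; last by rewrite mulmS osc_degD IH mulrS.
by rewrite mulr0n /osc_deg !big1 ?subr0 // => i _; rewrite mulmnE muln0.
Qed.

Lemma osc_deg1 i : osc_deg S U_(i) = if i \in S then 1 else -1.
Proof.
have sumU (B : {set 'I_N}) : \sum_(j in B) (U_(i)%MM j)%:Z = (i \in B)%:R.
  have [iB|iB] := boolP (i \in B).
    rewrite (bigD1 i) //= mnm1E eqxx big1 ?addr0 // => j /andP[_ /negPf ne].
    by rewrite mnm1E eq_sym ne.
  rewrite big1 // => j jB; rewrite mnm1E; case: eqP => // eij.
  by rewrite eij jB in iB.
by rewrite /osc_deg !sumU inE; case: (i \in S).
Qed.

Lemma graded_part_XM i k f : graded_part S k f ->
  graded_part S (k + osc_deg S U_(i)) ('X_i * f).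
Proof.
move=> /graded_partP fk; apply/graded_partP => a; rewrite mcoeff_XM.
case: (a i =P 0%N) => [_|/eqP ai]; first by rewrite eqxx.
move=> /fk <-; rewrite -osc_degD submK //; apply/mnm_lepP => j.
by rewrite mnm1E; case: eqP => [<-|] //=; rewrite lt0n.
Qed.

Lemma graded_part_deriv i k f : graded_part S k f ->
  graded_part S (k - osc_deg S U_(i)) (mderiv i f).
Proof.
move=> /graded_partP fk; apply/graded_partP => a; rewrite mcoeff_deriv.
have [f0|/fk <-] := eqVneq f@_(a + U_(i)) 0; first by rewrite f0 mul0rn eqxx.
by rewrite osc_degD addrK.
Qed.

(** For [i] in [T], differentiating removes a variable of degree $-1$, so the degree rises by one in
    both cases. *)
Lemma graded_part_oscQ i k f :
  graded_part S k f -> graded_part S (k + 1) (oscQ i f).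
Proof.
rewrite /oscQ => fk; case: ifP => iS.
  by have := graded_part_XM i fk; rewrite osc_deg1 iS.
by have := graded_part_deriv i fk; rewrite osc_deg1 iS opprK.
Qed.

Lemma graded_part_oscP i k f :
  graded_part S k f -> graded_part S (k - 1) (oscP i f).
Proof.
rewrite /oscP => fk; case: ifP => iS.
  by have := graded_part_deriv i fk; rewrite osc_deg1 iS.
by apply: graded_partN; have := graded_part_XM i fk; rewrite osc_deg1 iS.
Qed.

End WeylOperators.

(** * The orthogonal Lie algebra, Delta and eta *)

Section SwapIndex.
Variable n : nat.
Implicit Types i j : 'I_(n + n).

Definition swap_half i : 'I_(n + n) :=
  match split i with inl j => rshift n j | inr j => lshift n j end.

Lemma swap_lo (j : 'I_n) : swap_half (lshift n j) = rshift n j.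
Proof. by rewrite /swap_half (unsplitK (inl j)). Qed.

Lemma swap_hi (j : 'I_n) : swap_half (rshift n j) = lshift n j.
Proof. by rewrite /swap_half (unsplitK (inr j)). Qed.

Lemma swap_halfK : involutive swap_half.
Proof. by move=> i; case: (split_ordP i) => j ->; rewrite !(swap_lo, swap_hi).
  Qed.

End SwapIndex.

Lemma sum_leq_ord q p : \sum_(i < p) (q <= i)%N%:Z = (p - q)%N%:Z.
Proof.
elim: p => [|p IH]; first by rewrite big_ord0 sub0n.
by rewrite big_ord_recr /= IH; lia.
Qed.

Section SoOperators.
Variables (K : fieldType) (n s : nat).
Local Notation lo := (lshift n).
Local Notation hi := (@rshift n n).
Local Notation S := (osc_S n s).
Local Notation Q := (@oscQ K (n + n) S).
Local Notation P := (@oscP K (n + n) S).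
Local Notation "i ^'" := (swap_half i) (at level 1, format "i ^'").
Implicit Types (i j : 'I_(n + n)) (f g : {mpoly K[n + n]}) (k : int).

(** A uniform family covering the three kinds of spanning vectors of $so(2n)$. It is redundant:
    passing from $(i,j)$ to $(j',i')$ only changes the sign. *)
Definition so_gen i j : 'M[K]_(n + n) := delta_mx i j - delta_mx j^' i^'.
Definition so_op i j f := Q i (P j f) - Q j^' (P i^' f).

Lemma osc_rep_so_gen i j f : osc_rep S (so_gen i j) f = so_op i j f.
Proof.
rewrite /so_gen -scaleN1r addrC osc_rep_linearl !osc_rep_delta scaleN1r.
by rewrite addrC.
Qed.

Lemma so_gen_mem i j : so_gen i j \in so_even K n.
Proof.
have span_mem (X : 'M[K]_(n + n)) : X \in <[X]>%VS by apply: memv_line.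
have diag (a b : 'I_n) : so_gen (lo a) (lo b) \in so_even K n.
  rewrite /so_gen !swap_lo /so_even.
  apply: (subvP (addvSl _ _)); apply: (subvP (sumv_sup a _ (subvv _))) => //.
  exact: (subvP (sumv_sup b _ (subvv _))).
have opp a b c d : so_gen a b = - so_gen c d -> so_gen c d \in so_even K n ->
    so_gen a b \in so_even K n by move=> ->; rewrite memvN.
have gsym a b : so_gen b^' a^' = - so_gen a b.
  by rewrite /so_gen !swap_halfK opprB.
have lohi (a b : 'I_n) : so_gen (lo a) (hi b) \in so_even K n.
  have lt_case (c d : 'I_n) : (c < d)%N -> so_gen (lo c) (hi d) \in so_even K n.
    move=> lt_cd; rewrite /so_gen swap_lo swap_hi /so_even.
    apply: (subvP (addvSr _ _)); apply: (subvP (sumv_sup c _ (subvv _))) => //.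
    apply: (subvP (sumv_sup d lt_cd (subvv _))).
    exact: (subvP (addvSl _ _)).
  case: (ltngtP a b) => [/lt_case //|/lt_case ba|/val_inj->].
    by apply: (opp) ba; rewrite -gsym swap_lo swap_hi.
  by rewrite /so_gen swap_lo swap_hi subrr mem0v.
have hilo (a b : 'I_n) : so_gen (hi a) (lo b) \in so_even K n.
  have lt_case (c d : 'I_n) : (c < d)%N -> so_gen (hi d) (lo c) \in so_even K n.
    move=> lt_cd; rewrite /so_gen swap_lo swap_hi /so_even.
    apply: (subvP (addvSr _ _)); apply: (subvP (sumv_sup c _ (subvv _))) => //.
    apply: (subvP (sumv_sup d lt_cd (subvv _))).
    exact: (subvP (addvSr _ _)).
  case: (ltngtP b a) => [/lt_case //|/lt_case ba|/val_inj->].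
    by apply: (opp) ba; rewrite -gsym swap_lo swap_hi.
  by rewrite /so_gen swap_lo swap_hi subrr mem0v.
case: (split_ordP i) => a ->; case: (split_ordP j) => b -> //.
by apply: opp (diag b a); rewrite -gsym !swap_lo.
Qed.

(** The action is linear in the matrix, so this reduces invariance of a subspace to the operators
    [so_op i j]. *)
Lemma so_even_ind (A : 'M[K]_(n + n) -> Prop) :
  A 0 -> (forall X Y, A X -> A Y -> A (X + Y)) ->
  (forall (c : K) X, A X -> A (c *: X)) -> (forall i j, A (so_gen i j)) ->
  forall X, X \in so_even K n -> A X.
Proof.
move=> A0 AD AZ Agen X.
have Asum (I : Type) (r : seq I) (p : pred I) (F : I -> 'M[K]_(n + n)) :
    (forall x, p x -> A (F x)) -> A (\sum_(x <- r | p x) F x).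
  by move=> AF; elim/big_ind: _.
rewrite /so_even => /memv_addP[X1 X1in [X2 X2in ->]]; apply: (AD).
  have [Y YP ->] := memv_sumP X1in; apply: (Asum) => i _.
  have [Z ZP ->] := memv_sumP (YP i isT); apply: (Asum) => j _.
  have /vlineP[c ->] := ZP j isT; apply: (AZ).
  by have := Agen (lo i) (lo j); rewrite /so_gen !swap_lo.
have [Y YP ->] := memv_sumP X2in; apply: (Asum) => i _.
have [Z ZP ->] := memv_sumP (YP i isT); apply: (Asum) => j ij.
have /memv_addP[Z1 /vlineP[c1 ->] [Z2 /vlineP[c2 ->] ->]] := ZP j ij.
apply: AD; apply: (AZ).
  by have := Agen (lo i) (hi j); rewrite /so_gen swap_lo swap_hi.
by have := Agen (hi j) (lo i); rewrite /so_gen swap_lo swap_hi.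
Qed.

Fact osc_Delta_is_linear : linear (@osc_Delta K n s).
Proof.
move=> c f g; rewrite /osc_Delta scalerBr addrACA -opprD !scaler_sumr.
rewrite -!big_split; congr (_ - _); apply: eq_bigr => i _; last first.
  by rewrite mderivD mderivZ mulrDr -scalerAr.
by rewrite !(mderivD, mderivZ).
Qed.

Fact osc_eta_is_linear : linear (@osc_eta K n s).
Proof.
move=> c f g; rewrite /osc_eta scalerDr addrACA !scaler_sumr.
rewrite -!big_split; congr (_ + _); apply: eq_bigr => i _.
  by rewrite mulrDr -scalerAr.
by rewrite mderivD mderivZ mulrDr -scalerAr.
Qed.

HB.instance Definition _ := GRing.isLinear.Build K {mpoly K[n + n]}
  {mpoly K[n + n]} *:%R (@osc_Delta K n s) osc_Delta_is_linear.
HB.instance Definition _ := GRing.isLinear.Build K {mpoly K[n + n]}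
  {mpoly K[n + n]} *:%R (@osc_eta K n s) osc_eta_is_linear.

Hypothesis le_sn : (s <= n)%N.

Lemma lo_osc_S (j : 'I_n) : (lo j \in S) = (s <= j)%N.
Proof. by rewrite inE. Qed.

Lemma hi_osc_S (j : 'I_n) : hi j \in S.
Proof. by rewrite inE /= (leq_trans le_sn) ?leq_addr. Qed.

Lemma osc_DeltaE f : osc_Delta s f = \sum_(i < n) P (lo i) (P (hi i) f).
Proof.
rewrite /osc_Delta -sumrN [RHS](bigID (fun i : 'I_n => (s <= i)%N)) /=.
congr (_ + _); first by apply: eq_bigr => i si; rewrite /oscP hi_osc_S lo_osc_S
  si.
apply: eq_big => [i|i si]; first by rewrite -ltnNge.
by rewrite /oscP hi_osc_S lo_osc_S leqNgt si.
Qed.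

Lemma osc_etaE f : osc_eta s f = \sum_(i < n) Q (lo i) (Q (hi i) f).
Proof.
rewrite /osc_eta [RHS](bigID (fun i : 'I_n => (s <= i)%N)) /=.
congr (_ + _).
  by apply: eq_bigr => i si; rewrite /oscQ hi_osc_S lo_osc_S si mulrA.
apply: eq_big => [i|i si]; first by rewrite -ltnNge.
rewrite /oscQ hi_osc_S lo_osc_S leqNgt si /= mderivXM.
by rewrite eq_lrshift scale0r addr0.
Qed.

Lemma osc_Delta_P j f : osc_Delta s (P j f) = P j (osc_Delta s f).
Proof.
rewrite !osc_DeltaE linear_sum /=; apply: eq_bigr => i _.
by rewrite [P (hi i) _]oscPC [LHS]oscPC.
Qed.

Lemma osc_eta_Q j f : osc_eta s (Q j f) = Q j (osc_eta s f).
Proof.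
rewrite !osc_etaE linear_sum /=; apply: eq_bigr => i _.
by rewrite [Q (hi i) _]oscQC [LHS]oscQC.
Qed.

(** Only the pair containing [j] has a nonzero delta, and it selects the partner of [j]; a sum of
    commutators over all pairs thus collapses to one term. *)
Let sum_swap (F : 'I_(n + n) -> {mpoly K[n + n]}) j :
  \sum_(i < n) ((hi i == j)%:R *: F (lo i) + (lo i == j)%:R *: F (hi i)) = F
    j^'.
Proof.
rewrite big_split /=; case: (split_ordP j) => a ->.
  rewrite big1 ?add0r => [|i _]; last by rewrite eq_rlshift scale0r.
  rewrite (bigD1 a) //= eqxx scale1r big1 ?addr0 ?swap_lo // => i /negPf ia.
  by rewrite eq_lshift ia scale0r.
rewrite [X in _ + X]big1 ?addr0 => [|i _]; last by rewrite eq_lrshift scale0r.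
rewrite (bigD1 a) //= eqxx scale1r big1 ?addr0 ?swap_hi // => i /negPf ia.
by rewrite eq_rshift ia scale0r.
Qed.

Lemma osc_Delta_Q j f : osc_Delta s (Q j f) = Q j (osc_Delta s f) + P j^' f.
Proof.
rewrite !osc_DeltaE linear_sum /= -(sum_swap (fun i => P i f) j).
rewrite -big_split; apply: eq_bigr => i _ /=.
rewrite oscPQ raddfD /= oscPQ linearZ /=.
by rewrite -addrA; congr (_ + _); rewrite addrC.
Qed.

Lemma osc_eta_P j f : osc_eta s (P j f) = P j (osc_eta s f) - Q j^' f.
Proof.
rewrite !osc_etaE linear_sum /= -(sum_swap (fun i => Q i f) j) -sumrB.
apply: eq_bigr => i _ /=; rewrite oscPQ oscPQ raddfD /= linearZ /=.
rewrite [j == hi i]eq_sym [j == lo i]eq_sym.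
by rewrite -[X in _ = X - _]addrA addrK.
Qed.

(** The two commutators contribute $P_{i'}P_j-P_jP_{i'}$, which is zero. *)
Lemma osc_Delta_so i j f : osc_Delta s (so_op i j f) = so_op i j (osc_Delta s
  f).
Proof.
rewrite /so_op raddfB /= !osc_Delta_Q !osc_Delta_P swap_halfK [P j (P _
  _)]oscPC.
by rewrite opprD addrACA subrr addr0.
Qed.

(** Here the commutators leave $Q_{j'}Q_i-Q_iQ_{j'}$, which again is zero. *)
Lemma osc_eta_so i j f : osc_eta s (so_op i j f) = so_op i j (osc_eta s f).
Proof.
rewrite /so_op raddfB /= !osc_eta_Q !osc_eta_P !swap_halfK.
by rewrite [Q i (_ - _)]raddfB [Q j^' (_ - _)]raddfB /= [Q j^' (Q _ _)]oscQC
  opprB addrA subrK.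
Qed.

Lemma graded_part_so i j k f :
  graded_part S k f -> graded_part S k (so_op i j f).
Proof.
move=> fk; apply: graded_partD; last apply: graded_partN.
  by rewrite -[k](subrK 1); apply/graded_part_oscQ/graded_part_oscP.
by rewrite -[k](subrK 1); apply/graded_part_oscQ/graded_part_oscP.
Qed.

Lemma graded_part_Delta k f :
  graded_part S k f -> graded_part S (k - 2) (osc_Delta s f).
Proof.
move=> fk; rewrite osc_DeltaE; apply: graded_part_sum => i _.
have -> : k - 2 = k - 1 - 1 by ring.
by do 2!apply: graded_part_oscP.
Qed.

Lemma graded_part_eta k f :
  graded_part S k f -> graded_part S (k + 2) (osc_eta s f).
Proof.
move=> fk; rewrite osc_etaE; apply: graded_part_sum => i _.
have -> : k + 2 = k + 1 + 1 by ring.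
by do 2!apply: graded_part_oscQ.
Qed.

Lemma osc_deg_half (a : 'X_{1..n + n}) : osc_deg S a = \sum_(i < n)
  ((if (s <= i)%N then (a (lo i))%:Z else - (a (lo i))%:Z) + (a (hi i))%:Z).
Proof.
rewrite /osc_deg [\sum_(i in S) _]big_mkcond [\sum_(i in ~: S) _]big_mkcond /=.
rewrite !big_split_ord /= opprD addrACA -!sumrB -big_split.
apply: eq_bigr => i _; rewrite !finset.in_setC hi_osc_S lo_osc_S /= subr0.
by case: (s <= i)%N; rewrite ?subr0 ?sub0r.
Qed.

(** The commutator is the sum over pairs of $Q_cP_c+P_{c'}Q_{c'}$, diagonal on monomials. A pair
    inside [S] contributes its degree plus one, a mixed pair only its degree, and $n-s$ pairs lie
    inside [S]. *)
Lemma osc_Delta_eta k f : graded_part S k f ->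
  osc_Delta s (osc_eta s f)
  = osc_eta s (osc_Delta s f) + (k + n%:Z - s%:Z)%:~R *: f.
Proof.
move=> fk.
have -> : osc_Delta s (osc_eta s f) = osc_eta s (osc_Delta s f)
    + \sum_(i < n) (Q (lo i) (P (lo i) f) + P (hi i) (Q (hi i) f)).
  rewrite osc_etaE linear_sum osc_etaE -big_split; apply: eq_bigr => i _ /=.
  by rewrite !osc_Delta_Q raddfD /= swap_lo swap_hi addrA.
congr (_ + _); apply/mpolyP => a; rewrite mcoeffZ raddf_sum /=.
(* Off the support of [f] the degree of [a] need not be [k], but there both sides vanish. *)
have [fa0|fa0] := eqVneq f@_a 0; last (have /graded_partP/(_ _ fa0) <- := fk).
  rewrite fa0 mulr0 big1 // => i _.
  have := oscPQ (K := K) S (lo i) (lo i) f.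
  rewrite eqxx scale1r => /(canLR (addrK _)) <-.
  by rewrite mcoeffD mcoeffB !oscPQ_diag fa0 !mulr0 subr0 addr0.
rewrite osc_deg_half.
have PQ i : (Q i (P i f))@_a
    = (if i \in S then (a i)%:R else - (a i).+1%:R) * f@_a.
  have := oscPQ (K := K) S i i f.
  rewrite eqxx scale1r => /(canLR (addrK _)) <-; rewrite mcoeffB oscPQ_diag.
  by case: ifP => _; rewrite -natr1; ring.
under eq_bigr => i _ do rewrite mcoeffD PQ oscPQ_diag hi_osc_S lo_osc_S -mulrDl.
rewrite -mulr_suml; congr (_ * _).
rewrite -addrA; have -> : n%:Z - s%:Z = \sum_(i < n) (s <= i)%N%:Z.
  by rewrite sum_leq_ord subzn.
rewrite -big_split rmorph_sum; apply: eq_bigr => i _ /=.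
by case: (s <= i)%N; rewrite !(rmorphD, rmorphN) /= -!natr1; ring.
Qed.

End SoOperators.

(** * The decomposition of the graded parts *)

Section WeightBounds.
Variables (K : fieldType) (N : nat) (S : {set 'I_N}) (w : 'I_N -> nat).
Implicit Types (i : 'I_N) (f g : {mpoly K[N]}) (a b : 'X_{1..N}) (d : int).

(** The weights are left arbitrary because two choices are used: one counts $x_{n+1},\dots,x_{2n}$
    and bounds the nilpotency of $\Delta$, the other is the cocharacter of the irreducibility
    proof. *)
Definition mwt a : nat := \sum_(i < N) w i * a i.

(** The bound is strict, so that $d\le 0$ forces $f=0$ and starts the inductions on [d]. *)
Definition mwt_lt d f := forall a, f@_a != 0 -> (mwt a)%:Z < d.

(** The shift of weight under $Q_i$, opposite to that under $P_i$; the sign flips on [T], where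
    $Q_i$ differentiates. *)
Definition osc_wt i : int := if i \in S then (w i)%:Z else - (w i)%:Z.

Lemma mwtD a b : mwt (a + b)%MM = (mwt a + mwt b)%N.
Proof.
by rewrite /mwt -big_split; apply: eq_bigr => i _; rewrite mnmDE mulnDr.
Qed.

Lemma mwt1 i : mwt U_(i) = w i.
Proof.
rewrite /mwt (bigD1 i) //= mnm1E eqxx muln1 big1 ?addn0 // => j /negPf ne.
by rewrite mnm1E eq_sym ne muln0.
Qed.

Lemma mwt_ltD d f g : mwt_lt d f -> mwt_lt d g -> mwt_lt d (f + g).
Proof.
move=> fd gd a; rewrite mcoeffD; have [f0|/fd //] := eqVneq f@_a 0.
by rewrite f0 add0r => /gd.
Qed.

Lemma mwt_ltN d f : mwt_lt d f -> mwt_lt d (- f).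
Proof. by move=> fd a; rewrite mcoeffN oppr_eq0 => /fd. Qed.

Lemma mwt_lt_sum d (I : Type) (r : seq I) (A : pred I) (F : I -> {mpoly K[N]}) :
  (forall x, A x -> mwt_lt d (F x)) -> mwt_lt d (\sum_(x <- r | A x) F x).
Proof.
move=> Fd; elim/big_ind: _ => //; last exact: mwt_ltD.
by move=> a; rewrite mcoeff0 eqxx.
Qed.

Lemma mwt_lt_le d d' f : d <= d' -> mwt_lt d f -> mwt_lt d' f.
Proof. by move=> dd fd a /fd /lt_le_trans; apply. Qed.

Lemma mwt_ltXM i d f : mwt_lt d f -> mwt_lt (d + (w i)%:Z) ('X_i * f).
Proof.
move=> fd a; rewrite mcoeff_XM; case: (a i =P 0%N) => [_|/eqP ai].
  by rewrite eqxx.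
move=> /fd; rewrite -(ltrD2r (w i)%:Z) -{1}mwt1 -PoszD -mwtD submK //.
by apply/mnm_lepP => j; rewrite mnm1E; case: eqP => [<-|] //=; rewrite lt0n.
Qed.

Lemma mwt_lt_deriv i d f : mwt_lt d f -> mwt_lt (d - (w i)%:Z) (mderiv i f).
Proof.
move=> fd a; rewrite mcoeff_deriv.
have [f0|/fd] := eqVneq f@_(a + U_(i)) 0; first by rewrite f0 mul0rn eqxx.
by rewrite mwtD mwt1 PoszD ltrBrDr.
Qed.

Lemma mwt_ltQ i d f : mwt_lt d f -> mwt_lt (d + osc_wt i) (oscQ S i f).
Proof.
rewrite /oscQ /osc_wt; case: ifP => _; first exact: mwt_ltXM.
exact: mwt_lt_deriv.
Qed.

Lemma mwt_ltP i d f : mwt_lt d f -> mwt_lt (d - osc_wt i) (oscP S i f).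
Proof.
rewrite /oscP /osc_wt; case: ifP => _; first exact: mwt_lt_deriv.
by rewrite opprK => fd; apply/mwt_ltN/mwt_ltXM.
Qed.

Lemma mwt_lt0 d f : d <= 0 -> mwt_lt d f -> f = 0.
Proof.
move=> d0 fd; apply/mpolyP => a; rewrite mcoeff0; apply/eqP/contraT => /fd.
by move/lt_le_trans/(_ d0).
Qed.

Lemma mwt_lt_exists f : exists d : nat, mwt_lt d%:Z f.
Proof.
exists (\max_(a <- msupp f) mwt a).+1 => a; rewrite -mcoeff_msupp => fa.
by rewrite ltz_nat ltnS; apply: (leq_bigmax_seq (F := mwt)).
Qed.

End WeightBounds.

Arguments mwt_ltXM {K N w} i {d f} _.
Arguments mwt_lt_deriv {K N w} i {d f} _.
Arguments mwt_ltQ {K N} S {w} i {d f} _.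
Arguments mwt_ltP {K N} S {w} i {d f} _.
Arguments mwt_lt0 {K N w d f} _ _.


(** * Inverting $\eta\Delta+c$ in low degrees *)

Section Decomposition.
Variables (K : numFieldType) (n s : nat).
Local Notation lo := (lshift n).
Local Notation hi := (@rshift n n).
Local Notation S := (osc_S n s).
Implicit Types (f g h : {mpoly K[n + n]}) (k l : int).
Hypothesis le_sn : (s <= n)%N.

Let hi_wt (i : 'I_(n + n)) : nat := (n <= i)%N.

(** Every term of $\Delta$ differentiates once by some $x_{n+i}$ and multiplies by none of them, so
    $\Delta$ is locally nilpotent. *)
Lemma mwt_lt_Delta d f : mwt_lt hi_wt d f -> mwt_lt hi_wt (d - 1) (osc_Delta s
  f).
Proof.
move=> fd; rewrite (osc_DeltaE le_sn); apply: mwt_lt_sum => i _.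
have := mwt_ltP S (lo i) (mwt_ltP S (hi i) fd).
by rewrite /osc_wt hi_osc_S // /hi_wt /= leq_addr leqNgt ltn_ord /= if_same
  subr0.
Qed.

(** Applying $\Delta$ to the equation gives $(\eta\Delta+c+e)\Delta g=\Delta h$, where $e\le 0$ is
    the scalar of $[\Delta,\eta]$ in degree $l-2$. This is an equation of the same kind with a
    smaller bound; its solution $u$ yields $g=c^{-1}(h-\eta u)$. *)
Lemma eta_Delta_solve (N : nat) l (c : K) h :
  l + n%:Z - s%:Z <= 2 -> c < 0 -> graded_part S l h -> mwt_lt hi_wt N%:Z h ->
  exists2 g, graded_part S l g & osc_eta s (osc_Delta s g) + c *: g = h.
Proof.
elim: N l c h => [|N IH] l c h l2 c0 hl hN.
  exists 0; first exact: graded_part0.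
  by rewrite (mwt_lt0 (lexx _) hN) // scaler0 !raddf0 addr0.
pose e : K := (l - 2 + n%:Z - s%:Z)%:~R.
have e0 : e <= 0 by rewrite lerz0; lia.
have [||||g gl gh] := IH (l - 2) (c + e) (osc_Delta s h); first by lia.
- by rewrite -[0]addr0 ltr_leD.
- exact: graded_part_Delta.
- by apply: mwt_lt_le (mwt_lt_Delta hN); lia.
have cN0 : c != 0 by rewrite lt_eqF.
have el := graded_part_eta le_sn gl; rewrite subrK in el.
exists (c^-1 *: (h - osc_eta s g)).
  by apply/graded_partZ/graded_partD/graded_partN.
(* Here [g] is the solution $u$, and $\Delta h-\Delta\eta u=\Delta h-\eta\Delta u-eu=cu$. *)
suff -> : osc_Delta s (c^-1 *: (h - osc_eta s g)) = g.
  by rewrite scalerA divff // scale1r addrC subrK.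
rewrite linearZ /= [osc_Delta s (_ - _)]raddfB /= (osc_Delta_eta le_sn gl) -/e
  -gh scalerDl.
by rewrite opprD addrACA subrr add0r addrK scalerA mulVf // scale1r.
Qed.

(** By the same computation $\Delta g$ solves the homogeneous equation with $c+e$, hence vanishes by
    induction, and $cg=0$ remains. *)
Lemma eta_Delta_inj (N : nat) l (c : K) g :
  l + n%:Z - s%:Z <= 2 -> c < 0 -> graded_part S l g -> mwt_lt hi_wt N%:Z g ->
  osc_eta s (osc_Delta s g) + c *: g = 0 -> g = 0.
Proof.
elim: N l c g => [|N IH] l c g l2 c0 gl gN eg; first exact: mwt_lt0 (lexx _) gN.
pose e : K := (l - 2 + n%:Z - s%:Z)%:~R.
have e0 : e <= 0 by rewrite lerz0; lia.
have dl := graded_part_Delta le_sn gl.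
suff dg0 : osc_Delta s g = 0.
  move: eg; rewrite dg0 raddf0 add0r => /eqP.
  by rewrite scaler_eq0 lt_eqF //= => /eqP.
apply: (IH (l - 2) (c + e)) => //; first by lia.
- by rewrite -[0]addr0 ltr_leD.
- by apply: mwt_lt_le (mwt_lt_Delta gN); lia.
have := congr1 (osc_Delta s) eg.
rewrite raddfD raddf0 /= linearZ /= (osc_Delta_eta le_sn dl) -/e => dg0.
by rewrite scalerDl [c *: _ + _]addrC addrA.
Qed.

(** For $g$ of degree $k-2$, $f-\eta g$ is harmonic exactly when $(\eta\Delta+c)g=\Delta f$, with
    $c=k-2+n-s$ the scalar of $[\Delta,\eta]$; the bound on [k] gives $c\le -1$. *)
Lemma harmonic_decomposition k : k <= - (n%:Z - s%:Z - 1) ->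
  is_direct_sum (graded_part S k) (@harmonic_part K n s k)
    (fun f => exists2 g, graded_part S (k - 2) g & f = osc_eta s g).
Proof.
move=> hk.
have c0 : (k - 2 + n%:Z - s%:Z)%:~R < 0 :> K by rewrite ltrz0; lia.
have gk g : graded_part S (k - 2) g -> graded_part S k (osc_eta s g).
  by move/(graded_part_eta le_sn); rewrite subrK.
split=> [f|h [hk' dh0] [g gl hg]]; first split=> [fk|].
- have dfk := graded_part_Delta le_sn fk.
  have [N dN] := mwt_lt_exists hi_wt (osc_Delta s f).
  have [|g gl eg] := eta_Delta_solve _ c0 dfk dN; first by lia.
  exists (f - osc_eta s g), (osc_eta s g); split; last by rewrite subrK.
    split; first by apply/graded_partD/graded_partN/gk.
    by rewrite raddfB /= (osc_Delta_eta le_sn gl) eg subrr.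
  by exists g.
- by move=> [h [_ [[hk' _] [g gl ->] ->]]]; apply/graded_partD/gk.
have [N gN] := mwt_lt_exists hi_wt g.
rewrite hg in dh0 *; rewrite (eta_Delta_inj _ c0 gl gN) ?raddf0 //; first by
  lia.
by rewrite -(osc_Delta_eta le_sn gl).
Qed.

End Decomposition.

(** * Singular vectors and generation *)

Section Harmonics.
Variables (K : numFieldType) (n : nat) (t : 'I_n) (k : int).
Local Notation s := (t.+1).
Local Notation lo := (lshift n).
Local Notation hi := (@rshift n n).
Local Notation S := (osc_S n s).
Local Notation Q := (@oscQ K (n + n) S).
Local Notation P := (@oscP K (n + n) S).
Local Notation so := (@so_op K n s).
Local Notation "i ^'" := (swap_half i) (at level 1, format "i ^'").
Local Notation H := (@harmonic_part K n s k).
Implicit Types (f g u v : {mpoly K[n + n]}) (a b : 'X_{1..n + n}).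
Hypotheses (hk : k <= - (n%:Z - s%:Z - 1)) (k0 : k < 0).

Let le_sn : (s <= n)%N := ltn_ord t.

(* A cocharacter, as the weights of the x_i; the singular vectors for the
   root vectors that lower it are the multiples of x_s^-k. *)
Definition half_wt (i : 'I_n) : nat := if (i < t)%N then 2%N else (i == t).
Definition var_wt (i : 'I_(n + n)) : nat :=
  match split i with inl j => half_wt j | inr j => half_wt j end.
Local Notation wt := (osc_wt S var_wt).

Lemma var_wt_lo i : var_wt (lo i) = half_wt i.
Proof. by rewrite /var_wt (unsplitK (inl i)). Qed.

Lemma var_wt_hi i : var_wt (hi i) = half_wt i.
Proof. by rewrite /var_wt (unsplitK (inr i)). Qed.

Lemma half_wt0 (i : 'I_n) : (s <= i)%N -> half_wt i = 0%N.
Proof.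
by rewrite /half_wt -val_eqE => si; rewrite ltnNge ltnW //= gtn_eqF.
Qed.

Lemma half_wt_gt0 (i : 'I_n) : (i < s)%N -> (0 < half_wt i)%N.
Proof.
rewrite /half_wt ltnS => it; case: (ltnP i t) => // ti.
have -> : i = t by apply: val_inj; apply/eqP; rewrite eqn_leq it ti.
by rewrite eqxx.
Qed.

Lemma wt_lo i : wt (lo i) = - (half_wt i)%:Z.
Proof.
rewrite /osc_wt lo_osc_S var_wt_lo; case: leqP => // /half_wt0 ->.
by rewrite oppr0.
Qed.

Lemma wt_hi i : wt (hi i) = (half_wt i)%:Z.
Proof. by rewrite /osc_wt hi_osc_S // var_wt_hi. Qed.

Lemma wt_swap j : wt j^' = - wt j.
Proof.
by case: (split_ordP j) => i ->; rewrite !(swap_lo, swap_hi, wt_lo, wt_hi)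
  ?opprK.
Qed.

Lemma mwt_lt_so i j d f :
  mwt_lt var_wt d f -> mwt_lt var_wt (d + wt i - wt j) (so i j f).
Proof.
move=> fd; apply: mwt_ltD; last apply: mwt_ltN.
  have := mwt_ltQ S i (mwt_ltP S j fd); apply: mwt_lt_le.
  by rewrite addrAC.
have := mwt_ltQ S j^' (mwt_ltP S i^' fd); apply: mwt_lt_le.
by rewrite !wt_swap opprK.
Qed.

(* Delta and eta can be summed starting from either member of a pair c, c'
   contained in S; the two choices give two eigenvalues, and only their sum is
   always negative. *)
Definition pick_half (flip : bool) (i : 'I_n) : 'I_(n + n) :=
  if flip && (s <= i)%N then hi i else lo i.

Definition diag_eig flip a : int :=
  \sum_(i < n) (if (s <= i)%N then (a (pick_half flip i)).+1%:Z
                else - (a (pick_half flip i))%:Z) - 1.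

(** Since exponents are nonnegative, the sum is at most twice degree plus $n-s$, minus 2; the bound
    on [k] makes this at most $-2$. *)
Lemma diag_eig_lt0 a : osc_deg S a = k - 1 ->
  diag_eig false a + diag_eig true a < 0.
Proof.
move=> degE.
have nsE : n%:Z - s%:Z = \sum_(i < n) (s <= i)%N%:Z.
  by rewrite sum_leq_ord subzn.
suff : diag_eig false a + diag_eig true a
    <= 2 * (k - 1) + 2 * (n%:Z - s%:Z) - 2 by lia.
rewrite -degE osc_deg_half // nsE /diag_eig !mulr_sumr -big_split addrACA
  -big_split /=.
rewrite lerD2r; apply: ler_sum => i _; rewrite /pick_half /=.
by case: (s <= i)%N; lia.
Qed.

Lemma diag_eigE flip g a :
  (\sum_(i < n) P (pick_half flip i) (Q (pick_half flip i) g) - g)@_a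
  = (diag_eig flip a)%:~R * g@_a.
Proof.
rewrite mcoeffB raddf_sum /= /diag_eig rmorphB /= mulrBl mul1r rmorph_sum.
rewrite mulr_suml; congr (_ - _); apply: eq_bigr => i _ /=.
rewrite oscPQ_diag /pick_half; case: (leqP s i) => si; rewrite ?andbT ?andbF.
  by case: flip; rewrite ?hi_osc_S ?lo_osc_S ?si.
by rewrite lo_osc_S leqNgt si /= rmorphN.
Qed.

Lemma Delta_pick flip f : osc_Delta s f
  = \sum_(i < n) P (pick_half flip i) (P (pick_half flip i)^' f).
Proof.
rewrite osc_DeltaE //; apply: eq_bigr => i _; rewrite /pick_half.
by case: ifP => _; rewrite ?swap_hi ?swap_lo // oscPC.
Qed.

Lemma eta_pick flip f : osc_eta s f
  = \sum_(i < n) Q (pick_half flip i)^' (Q (pick_half flip i) f).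
Proof.
rewrite osc_etaE //; apply: eq_bigr => i _; rewrite /pick_half.
by case: ifP => _; rewrite ?swap_hi ?swap_lo // oscQC.
Qed.

Lemma wt_pick_le0 flip i : wt (pick_half flip i) <= 0.
Proof.
rewrite /pick_half; case: ifP => [/andP[_ si]|_].
  by rewrite wt_hi half_wt0.
by rewrite wt_lo oppr_le0.
Qed.

Lemma pick_half_eq flip i (l : 'I_n) : (l < s)%N ->
  (lo l == pick_half flip i) = (l == i).
Proof.
move=> ls; rewrite /pick_half; case: ifP => [/andP[_ si]|_].
  rewrite eq_lrshift; apply/esym/negbTE; apply: contraTneq ls => ->.
  by rewrite -leqNgt.
by rewrite eq_lshift.
Qed.

Lemma mderiv0_mnm i f a : mderiv i f = 0 -> f@_a != 0 -> a i = 0%N.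
Proof.
move=> df0 fa; have := mcoeff_XD i f a; rewrite df0 mulr0 mcoeff0 => /esym/eqP.
by rewrite mulf_eq0 (negPf fa) orbF pnatr_eq0 => /eqP.
Qed.

(** A negative degree forces $x_s$ to occur; the vanishing products then exclude all variables with
    index in [S] not yet excluded, and the degree fixes the exponent. *)
Lemma mnm_xs a : osc_deg S a = k ->
  (forall l : 'I_n, (l < s)%N -> a (hi l) = 0%N) ->
  (forall l : 'I_n, (l < t)%N -> a (lo l) = 0%N) ->
  (forall i : 'I_n, (s <= i)%N ->
     (a (lo t) * a (lo i) = 0)%N /\ (a (lo t) * a (hi i) = 0)%N) ->
  a = (U_(lo t) *+ `|k|)%MM.
Proof.
rewrite osc_deg_half // => degE a_hi a_lo a_z.
have at0 : a (lo t) != 0%N.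
  apply: contraTneq k0 => at0; rewrite -leNgt -degE sumr_ge0 // => i _.
  case: (ltngtP t i) => [_|it|/val_inj <-]; rewrite ?at0 ?addr_ge0 //.
  by rewrite a_lo.
have {}a_z (i : 'I_n) : (s <= i)%N -> a (lo i) = 0%N /\ a (hi i) = 0%N.
  by move=> /a_z[/eqP + /eqP]; rewrite !muln_eq0 (negPf at0) /= => /eqP -> /eqP.
have atk : a (lo t) = `|k|%N.
  suff <- : - (a (lo t))%:Z = k by rewrite abszN absz_nat.
  rewrite -degE (bigD1 t) //= ltnn a_hi // addr0 big1 ?addr0 // => i.
  rewrite -val_eqE neq_ltn => /orP[it|ti].
    by rewrite a_lo // a_hi 1?leqW // ltnNge ltnW.
  by rewrite ti; have [-> ->] := a_z i ti.
apply/mnmP => j; rewrite mulmnE mnm1E.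
case: (split_ordP j) => i ->; last first.
  rewrite eq_lrshift mul0n; case: (ltnP t i) => [/a_z[] //|it].
  exact: a_hi.
rewrite eq_lshift; case: eqP => [<-|/eqP]; first by rewrite mul1n atk.
rewrite -val_eqE neq_ltn mul0n => /orP[ti|it]; last exact: a_lo.
by have [] := a_z i ti.
Qed.

(** * Vectors killed by the lowering operators *)

Section Singular.
Variable f : {mpoly K[n + n]}.
Hypotheses (fH : H f)
  (sing : forall (l : 'I_n) j, (l < s)%N -> wt (lo l) < wt j -> so (lo l) j f =
    0).

Let singQ (l : 'I_n) j : (l < s)%N -> wt (lo l) < wt j ->
  Q (lo l) (P j f) = Q j^' (P (hi l) f).
Proof.
by move=> ls /(sing ls) /eqP; rewrite /so_op subr_eq0 swap_lo => /eqP.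
Qed.

(** With $g=P_{l'}f$, singularity gives $Q_cg=Q_lP_{c'}f$ for each chosen $c$. Moving $P_c$ past
    $Q_l$ and summing gives $\sum_cP_cQ_cg=Q_l\Delta f+g=g$. *)
Lemma singular_hi (l : 'I_n) : (l < s)%N -> mderiv (hi l) f = 0.
Proof.
move=> ls; have [fk f0] := fH.
have -> : mderiv (hi l) f = P (hi l) f by rewrite /oscP hi_osc_S.
set g := P (hi l) f.
have gk : graded_part S (k - 1) g by apply: graded_part_oscP.
have eig0 flip a : (diag_eig flip a)%:~R * g@_a = 0.
  rewrite -diag_eigE.
  suff -> : \sum_(i < n) P (pick_half flip i) (Q (pick_half flip i) g) - g
      = Q (lo l) (osc_Delta s f) by rewrite f0 raddf0 mcoeff0.
  rewrite (Delta_pick flip) linear_sum /=.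
  have gE : g = \sum_(i < n) (l == i)%:R *: g.
    rewrite (bigD1 l) //= eqxx scale1r big1 ?addr0 // => i /negPf.
    by rewrite eq_sym => ->; rewrite scale0r.
  rewrite [X in _ - X]gE -sumrB; apply: eq_bigr => i _.
  (* The chosen index has weight at most 0, so its partner has weight at least 0, above the negative
     weight of [lo l], as [singQ] requires. *)
  have -> : Q (pick_half flip i) g = Q (lo l) (P (pick_half flip i)^' f).
    rewrite singQ // ?swap_halfK // wt_swap wt_lo (@lt_le_trans _ _ 0) //.
      by rewrite oppr_lt0 ltz_nat half_wt_gt0.
    by rewrite oppr_ge0 wt_pick_le0.
  rewrite oscPQ eq_sym pick_half_eq //; case: eqP => [<-|_].
    by rewrite /pick_half leqNgt ls andbF swap_lo addrK.
  by rewrite !scale0r addr0 subr0.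
(* On the support of [g] both eigenvalues would be zero, against the negativity of their sum. *)
apply/mpolyP => a; rewrite mcoeff0; apply/eqP/contraT => ga.
have /graded_partP/(_ a ga)/diag_eig_lt0 := gk.
have := eig0 false a; have := eig0 true a => /eqP + /eqP.
rewrite !mulf_eq0 (negPf ga) !orbF !intr_eq0 => /eqP -> /eqP ->.
by rewrite ltxx.
Qed.

(** Once $P_{l'}f=0$, singularity reads $\partial_{x_l}P_jf=0$. Taking $P_j$ to be multiplication by
    $-x_s$ excludes $x_l$ for $l<s$; taking $l=s$ and $j$ in [S] of nonnegative weight shows that
    $x_s$ and $x_j$ never occur together. Then [mnm_xs] applies to each monomial. *)
Lemma singular_eq : exists c : K, f = c *: 'X_(lo t) ^+ `|k|%N.
Proof.
exists f@_(U_(lo t) *+ `|k|%N); apply/mpolyP => a.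
rewrite mpolyXn mcoeffZ mcoeffX.
have [fa0|fa] := eqVneq f@_a 0.
  by case: eqP => [->|_]; rewrite ?mulr0 // mulr1 fa0.
have Phi (l : 'I_n) : (l < s)%N -> P (hi l) f = 0.
  by rewrite /oscP hi_osc_S //; apply: singular_hi.
have QP0 (l : 'I_n) j : (l < s)%N -> wt (lo l) < wt j -> Q (lo l) (P j f) = 0.
  by move=> ls lj; rewrite singQ // Phi // raddf0.
have a_hi (l : 'I_n) : (l < s)%N -> a (hi l) = 0%N.
  by move=> ls; apply: mderiv0_mnm fa; apply: singular_hi.
have a_lo (l : 'I_n) : (l < t)%N -> a (lo l) = 0%N.
  move=> lt_lt; have ls : (l < s)%N by apply: leqW.
  apply: mderiv0_mnm fa.
  have lt_wt : wt (lo l) < wt (lo t).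
    by rewrite !wt_lo /half_wt lt_lt ltnn eqxx.
  have := QP0 l (lo t) ls lt_wt; rewrite /oscQ /oscP !lo_osc_S leqNgt ls /=
    ltnn.
  rewrite mderivN mderivXM eq_lshift.
  have -> : (l == t) = false by rewrite -val_eqE /= ltn_eqF.
  rewrite scale0r addr0 => /eqP; rewrite oppr_eq0 mulf_eq0 => /orP[|/eqP //].
  by move/eqP/(congr1 (mcoeff U_(lo t))); rewrite mcoeffXU eqxx mcoeff0 =>
    /eqP; rewrite oner_eq0.
have a_z (j : 'I_(n + n)) : j \in S -> 0 <= wt j -> (a (lo t) * a j)%N = 0%N.
  move=> jS wj; have := QP0 t j (ltnSn t).
  rewrite wt_lo (lt_le_trans _ wj); last first.
    by rewrite oppr_lt0 ltz_nat half_wt_gt0.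
  move=> /(_ isT); rewrite /oscQ /oscP jS lo_osc_S ltnn => d0.
  have := mcoeff_XD (lo t) ('X_j * mderiv j f) a.
  rewrite mderivXM.
  have -> : (lo t == j) = false.
    by apply: contraTF jS => /eqP <-; rewrite lo_osc_S ltnn.
  rewrite d0 mulr0 scale0r addr0 mulr0 mcoeff0 mcoeff_XD => /esym/eqP.
  by rewrite !mulf_eq0 (negPf fa) orbF -mulf_eq0 -natrM pnatr_eq0 => /eqP.
have [fk _] := fH; have /graded_partP/(_ a fa) := fk.
move=> degE; have -> : a = (U_(lo t) *+ `|k|)%MM; last by rewrite eqxx mulr1.
apply: mnm_xs => // i si; split; apply: a_z; rewrite ?hi_osc_S ?lo_osc_S //.
  by rewrite wt_lo half_wt0.
by rewrite wt_hi.
Qed.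

End Singular.

(** * Generation of the graded part modulo the image of $\eta$ *)

Section Generation.
Variable Z : {mpoly K[n + n]} -> Prop.
Hypotheses (ZD : forall f g, Z f -> Z g -> Z (f + g))
  (ZZ : forall (c : K) f, Z f -> Z (c *: f)) (Z0 : Z 0)
  (Zso : forall i j f, Z f -> Z (so i j f))
  (Zeta : forall g, graded_part S (k - 2) g -> Z (osc_eta s g))
  (Zxs : Z ('X_(lo t) ^+ `|k|%N)).

Let Zcong f g : Z (f - g) -> Z g -> Z f.
Proof. by move=> Zfg Zg; rewrite -[f](subrK g); apply: ZD. Qed.

Let Zsum (I : Type) (r : seq I) (A : pred I) (F : I -> {mpoly K[n + n]}) :
  (forall x, A x -> Z (F x)) -> Z (\sum_(x <- r | A x) F x).
Proof. by move=> ZF; elim/big_ind: _. Qed.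

Section Step.
Variable d : nat.
Hypothesis IHd : forall a, osc_deg S a = k -> (mwt var_wt a < d)%N -> Z 'X_[a].

Let IHf f : graded_part S k f -> mwt_lt var_wt d f -> Z f.
Proof.
move=> /graded_partP fk fd; rewrite [f]mpolyE big_seq; apply: Zsum => a.
rewrite mcoeff_msupp => fa; apply: ZZ; apply: IHd; first exact: fk.
by have := fd a fa; rewrite ltz_nat.
Qed.

(** The transpose of [singular_hi]: modulo $\eta P_lG$, each eigenvalue times $Q_{l'}G$ is a sum of
    so(2n)-images of the $Q_cG$. These lie in [Z] by induction, since $Q_c$ does not raise the
    weight, whereas $Q_{l'}G$ itself may exceed the bound. *)
Let Z_hi_mnm (l : 'I_n) b : (l < s)%N -> osc_deg S b = k - 1 ->
  (mwt var_wt b < d)%N -> Z (Q (hi l) 'X_[b]).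
Proof.
move=> ls bk bd; set G : {mpoly K[n + n]} := 'X_[b].
have Gk : graded_part S (k - 1) G.
  apply/graded_partP => a; rewrite mcoeffX.
  by have [<-|_] := eqVneq b a; rewrite ?bk // eqxx.
have Gd : mwt_lt var_wt d G.
  move=> a; rewrite mcoeffX; have [<-|_] := eqVneq b a; last by rewrite eqxx.
  by rewrite ltz_nat.
have eigZ flip : Z ((diag_eig flip b)%:~R *: Q (hi l) G).
  have -> : (diag_eig flip b)%:~R *: Q (hi l) G = Q (hi l)
      (\sum_(i < n) P (pick_half flip i) (Q (pick_half flip i) G) - G).
    rewrite -linearZ /=; congr (Q _ _); apply/mpolyP => a.
    rewrite diag_eigE mcoeffZ /G mcoeffX; have [->|_] := eqVneq b a => //.
    by rewrite !mulr0.
  rewrite [Q _ _]raddfB raddf_sum /=.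
  have : Z (osc_eta s (P (lo l) G)).
    apply: Zeta; have -> : k - 2 = k - 1 - 1 by ring.
    exact: graded_part_oscP.
  apply: Zcong; rewrite (eta_pick flip).
  have gE : Q (hi l) G = \sum_(i < n) (l == i)%:R *: Q (hi l) G.
    rewrite (bigD1 l) //= eqxx scale1r big1 ?addr0 // => i /negPf.
    by rewrite eq_sym => ->; rewrite scale0r.
  rewrite [X in _ - X - _]gE -!sumrB; apply: Zsum => i _.
  set c := pick_half flip i.
  have -> : Q (hi l) (P c (Q c G)) - (l == i)%:R *: Q (hi l) G
      - Q c^' (Q c (P (lo l) G)) = - so c^' (lo l) (Q c G).
    rewrite /so_op swap_halfK swap_lo [P (lo l) (Q _ _)]oscPQ opprB.
    rewrite [Q c^' (_ + _)]raddfD /= [Q c^' (_ *: _)]linearZ /= pick_half_eq //.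
    rewrite opprD addrA addrAC; congr (_ - _ - _).
    case: (l =P i) => [li|_]; last by rewrite !scale0r.
    by rewrite /c -li /pick_half leqNgt ls andbF swap_lo.
  rewrite -scaleN1r; apply: ZZ; apply: Zso; apply: IHf.
    by rewrite -[k](subrK 1); apply: graded_part_oscQ.
  apply: mwt_lt_le (mwt_ltQ S c Gd).
  by rewrite gerDl wt_pick_le0.
(* Either eigenvalue alone may be zero; their sum is negative, hence invertible. *)
have := ZD (eigZ false) (eigZ true); rewrite -scalerDl -rmorphD /=.
have /ltr0_neq0 : diag_eig false b + diag_eig true b < 0 by apply: diag_eig_lt0.
rewrite -(intr_eq0 K) => e0 /(ZZ ((diag_eig false b + diag_eig true b)%:~R^-1)).
by rewrite scalerA mulVf ?scale1r.
Qed.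

Let Z_hi (l : 'I_n) g : (l < s)%N -> graded_part S (k - 1) g ->
  mwt_lt var_wt d g -> Z (Q (hi l) g).
Proof.
move=> ls /graded_partP gk gd; rewrite [g]mpolyE raddf_sum /= big_seq.
apply: Zsum => a; rewrite mcoeff_msupp linearZ /= => ga; apply: ZZ.
by apply: Z_hi_mnm; rewrite ?gk //; have := gd a ga; rewrite ltz_nat.
Qed.

(** Applying [so j (lo l)] to [f] gives $Q_jP_lf-Q_{l'}P_{j'}f$, and [Z_hi] covers the second term
    because $P_{j'}$ does not raise the weight. *)
Let Z_QP (l : 'I_n) j f : (l < s)%N -> wt j <= 0 -> graded_part S k f ->
  mwt_lt var_wt d f -> Z (Q j (P (lo l) f)).
Proof.
move=> ls wj fk fd; apply: (@Zcong _ (Q (hi l) (P j^' f))).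
  by rewrite -(swap_lo l); apply: Zso; apply: IHf.
apply: Z_hi => //; first exact: graded_part_oscP.
by apply: mwt_lt_le (mwt_ltP S j^' fd); rewrite wt_swap opprK gerDl.
Qed.

Let mnm_graded b : osc_deg S b = k -> graded_part S k ('X_[b] : {mpoly K[n +
  n]}).
Proof.
move=> bk; apply/graded_partP => c; rewrite mcoeffX.
by have [<-|_] := eqVneq b c; rewrite ?bk // eqxx.
Qed.

Let mnm_mwt_lt b : (mwt var_wt b < d)%N ->
  mwt_lt var_wt d ('X_[b] : {mpoly K[n + n]}).
Proof.
move=> bd c; rewrite mcoeffX; have [<-|_] := eqVneq b c; last by rewrite eqxx.
by rewrite ltz_nat.
Qed.

Let subU a i : a i != 0%N -> exists b, a = (U_(i) + b)%MM.
Proof.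
move=> ai; exists (a - U_(i))%MM; rewrite addmC submK //; apply/mnm_lepP => j.
by rewrite mnm1E; case: eqP => [<-|] //=; rewrite lt0n.
Qed.

(** Every monomial other than $x_s^{-k}$ is obtained, up to a nonzero scalar, from one of smaller
    weight by [Z_hi_mnm] or [Z_QP]. *)
Lemma generation_step a : osc_deg S a = k -> (mwt var_wt a <= d)%N -> Z 'X_[a].
Proof.
move=> ak ad.
have XU i b : 'X_[U_(i) + b] = 'X_i * 'X_[b] :> {mpoly K[n + n]}.
  exact: mpolyXD.
(* First case: some $x_{n+l}$ with $l\le s$ occurs; removing it lowers the weight strictly. *)
case: (pickP [pred l : 'I_n | (l < s)%N && (a (hi l) != 0%N)]).
  move=> l /andP[ls /subU[b aE]].
  have := @Z_hi_mnm l b ls; rewrite aE XU /oscQ hi_osc_S //; apply.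
    by move: ak; rewrite aE osc_degD osc_deg1 hi_osc_S // => <-; ring.
  apply: leq_trans ad; rewrite aE mwtD mwt1 var_wt_hi -add1n leq_add2r.
  exact: half_wt_gt0.
move=> a_hi0; have a_hi (l : 'I_n) : (l < s)%N -> a (hi l) = 0%N.
  by move=> ls; have := a_hi0 l; rewrite /= ls => /negbT; rewrite negbK => /eqP.
(* Second case: $x_lx_j$ divides the monomial, with $l$ in [T] and $j$ in [S] of weight 0; this
   product is $-Q_jP_l$ applied to the quotient. *)
case: (pickP [pred lj : 'I_n * 'I_(n + n) | [&& (lj.1 < s)%N, lj.2 \in S,
    wt lj.2 == 0, a (lo lj.1) != 0%N & a lj.2 != 0%N]]).
  move=> [l j] /and5P[/= ls jS /eqP wj al aj].
  have [b aE] := subU al; have lj : lo l != j.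
    by apply: contraTneq jS => <-; rewrite lo_osc_S -ltnNge.
  have /subU[b' bE] : b j != 0%N.
    by move: aj; rewrite aE mnmDE mnm1E (negPf lj).
  have b'k : osc_deg S b' = k.
    move: ak; rewrite aE bE !osc_degD !osc_deg1 jS lo_osc_S leqNgt ls /= => <-.
    by ring.
  have b'd : (mwt var_wt b' < d)%N.
    apply: leq_trans ad; rewrite aE bE !mwtD !mwt1 var_wt_lo.
    by have := half_wt_gt0 ls; lia.
  have wj0 : wt j <= 0 by rewrite wj.
  have := ZZ (-1) (Z_QP ls wj0 (mnm_graded b'k) (mnm_mwt_lt b'd)).
  rewrite scaleN1r.
  rewrite /oscQ jS /oscP lo_osc_S leqNgt ls /= mulrN opprK aE bE !XU.
  by rewrite mulrCA.
move=> a_z0.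
have a_z (l : 'I_n) j : (l < s)%N -> j \in S -> wt j = 0 -> (a (lo l) * a j =
  0)%N.
  move=> ls jS wj; have := a_z0 (l, j); rewrite /= ls jS wj eqxx /=.
  by move/negbT; rewrite negb_and !negbK -muln_eq0 => /eqP.
(* Third case: some $x_l$ with $l<s$ occurs. Replacing it by $x_s$ lowers the weight from 2 to 1,
   and $Q_sP_l$ leads back with the factor $-(\alpha_s+1)$. *)
case: (pickP [pred l : 'I_n | (l < t)%N && (a (lo l) != 0%N)]).
  move=> l /andP[lt_lt al]; have [b aE] := subU al.
  have ls : (l < s)%N by apply: leqW.
  have tS : lo t \in S = false by rewrite lo_osc_S ltnn.
  have lS : lo l \in S = false by rewrite lo_osc_S leqNgt ls.
  have ck : osc_deg S (U_(lo t) + b) = k.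
    by rewrite -ak aE !osc_degD !osc_deg1 tS lS.
  have cd : (mwt var_wt (U_(lo t) + b) < d)%N.
    apply: leq_trans ad; rewrite aE !mwtD !mwt1 !var_wt_lo /half_wt lt_lt ltnn.
    by rewrite eqxx.
  have wj0 : wt (lo t) <= 0 by rewrite wt_lo oppr_le0.
  have := ZZ (- (a (lo t)).+1%:R^-1)
    (Z_QP ls wj0 (mnm_graded ck) (mnm_mwt_lt cd)).
  rewrite /oscQ /oscP tS lS mderivN scalerN scaleNr opprK -XU mderivX.
  have -> : (U_(lo l) + (U_(lo t) + b))%MM = (U_(lo t) + a)%MM.
    by rewrite aE addmA [X in (X + b)%MM]addmC -addmA.
  by rewrite mnmDE mnm1E eqxx add1n scalerA mulVf ?pnatr_eq0 // scale1r
    [X in (X - _)%MM]addmC addmK.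
move=> a_lo0; rewrite (_ : a = (U_(lo t) *+ `|k|)%MM) -?mpolyXn //.
apply: mnm_xs => // [l lt_lt|i si].
  have := a_lo0 l; rewrite /= lt_lt => /negbT; rewrite negbK => /eqP //.
split; apply: a_z; rewrite ?hi_osc_S ?lo_osc_S //.
  by rewrite wt_lo half_wt0.
by rewrite wt_hi half_wt0.
Qed.

End Step.

Lemma graded_generation f : graded_part S k f -> Z f.
Proof.
move=> /graded_partP fk; rewrite [f]mpolyE big_seq; apply: Zsum => a.
rewrite mcoeff_msupp => /fk ak; apply: ZZ.
have [d] := ubnP (mwt var_wt a); elim: d a ak => // d IH a ak.
by rewrite ltnS; apply: generation_step => // b; apply: IH.
Qed.

End Generation.

(** * Submodules of the harmonic part and irreducibility *)

Local Notation xs := ('X_(lo t) ^+ `|k|%N : {mpoly K[n + n]}).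
Local Notation submodule := (is_submodule (@osc_rep K (n + n) S) (so_even K n)).

Lemma harmonic_submodule : submodule H.
Proof.
have H0 : H 0 by split; [exact: graded_part0 | rewrite raddf0].
have HD u v : H u -> H v -> H (u + v).
  move=> [uk u0] [vk v0]; split; first exact: graded_partD.
  by rewrite raddfD /= u0 v0 addr0.
have HZ (c : K) u : H u -> H (c *: u).
  move=> [uk u0]; split; first exact: graded_partZ.
  by rewrite linearZ /= u0 scaler0.
split=> // X u Xso uH; have [uk u0] := uH; rewrite -/(osc_rep_at S u X).
elim/so_even_ind: Xso => [|Y Y' YH YH'|c Y YH|i j].
- by rewrite raddf0.
- by rewrite raddfD; apply: HD.
- by rewrite linearZ; apply: HZ.
rewrite /osc_rep_at osc_rep_so_gen; split; first exact: graded_part_so.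
by rewrite osc_Delta_so // u0 -osc_rep_so_gen raddf0.
Qed.

Lemma xs_harmonic : H xs.
Proof.
rewrite mpolyXn; split.
  apply/graded_partP => a; rewrite mcoeffX; case: (_ =P a) => [<- _|_].
    by rewrite osc_degMn osc_deg1 lo_osc_S ltnn; lia.
  by rewrite eqxx.
have d0 j : mderiv (hi j) ('X_[U_(lo t) *+ `|k|] : {mpoly K[n + n]}) = 0.
  by rewrite mderivX mulmnE mnm1E eq_lrshift mul0n scale0r.
rewrite /osc_Delta !big1 ?subr0 // => i _; rewrite d0 ?raddf0 //.
by rewrite mulr0.
Qed.

(** Each lowering operator with a nonzero result decreases the weight bound, so the process stops at
    a nonzero singular vector, a multiple of $x_s^{-k}$. *)
Lemma submodule_xs (W : {mpoly K[n + n]} -> Prop) u :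
  submodule W -> (forall w, W w -> H w) -> W u -> u != 0 -> W xs.
Proof.
move=> [W0 WD WZ Wact] WH.
have [d] := mwt_lt_exists var_wt u.
elim: d u => [|d IH] u ud Wu u0; first by rewrite (mwt_lt0 (lexx _) ud) eqxx in
  u0.
case: (pickP [pred lj : 'I_n * 'I_(n + n) | [&& (lj.1 < s)%N,
    wt (lo lj.1) < wt lj.2 & so (lo lj.1) lj.2 u != 0]]) => [[l j] | sing].
  move=> /and3P[/= ls lj]; apply: IH.
    by apply: mwt_lt_le (mwt_lt_so ud); lia.
  by rewrite -osc_rep_so_gen; apply: Wact => //; apply: so_gen_mem.
have [|c uE] := singular_eq (WH u Wu).
  move=> l j ls lj; have := sing (l, j); rewrite /= ls lj /=.
  by move/negbT; rewrite negbK => /eqP.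
have c0 : c != 0 by apply: contraNneq u0 => c0; rewrite uE c0 scale0r.
by have := WZ c^-1 u Wu; rewrite uE scalerA mulVf // scale1r.
Qed.

(** Generation gives $u=w+\eta g$ with $w\in W$; then $\eta g=u-w$ is harmonic, so it vanishes by
    the direct sum. *)
Lemma xs_generates (W : {mpoly K[n + n]} -> Prop) :
  submodule W -> W xs -> forall u, H u -> W u.
Proof.
move=> [W0 WD WZ Wact] Wxs u Hu.
have [H0 HD HZ Hact] := harmonic_submodule.
(* Harmonicity of [w] is recorded because [W] is not assumed to lie in [H]. *)
pose Z f := exists w g,
  [/\ W w, H w, graded_part S (k - 2) g & f = w + osc_eta s g].
have [uk _] := Hu; have [||||||w [g [Ww Hw gk uE]]] := @graded_generation Z _ _
  _ _ _ _ u uk.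
- move=> f f' [w [g [Ww Hw gk ->]]] [w' [g' [Ww' Hw' gk' ->]]].
  exists (w + w'), (g + g'); split; [exact: WD|exact: HD|exact: graded_partD|].
  by rewrite raddfD addrACA.
- move=> c f [w [g [Ww Hw gk ->]]]; exists (c *: w), (c *: g).
  split; [exact: WZ|exact: HZ|exact: graded_partZ|].
  by rewrite scalerDr linearZ.
- by exists 0, 0; split=> //; rewrite ?raddf0 ?addr0 //; apply: graded_part0.
- move=> i j f [w [g [Ww Hw gk ->]]]; exists (so i j w), (so i j g).
  split; [| |exact: graded_part_so|].
  + by rewrite -osc_rep_so_gen; apply: Wact => //; apply: so_gen_mem.
  + by rewrite -osc_rep_so_gen; apply: Hact => //; apply: so_gen_mem.
  + by rewrite osc_eta_so // -!osc_rep_so_gen raddfD.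
- move=> g gk; exists 0, g; split=> //; by rewrite add0r.
- exists xs, 0; split=> //; [exact: xs_harmonic|exact: graded_part0|].
  by rewrite raddf0 addr0.
suff e0 : osc_eta s g = 0 by rewrite uE e0 addr0.
have [_ dir] := harmonic_decomposition K le_sn hk.
apply: dir; last by exists g.
have -> : osc_eta s g = u + (-1) *: w by rewrite uE scaleN1r addrAC subrr add0r.
by apply: HD => //; apply: HZ.
Qed.

Lemma harmonic_irreducible :
  irreducible_module (@osc_rep K (n + n) S) (so_even K n) H.
Proof.
split; first exact: harmonic_submodule.
  exists xs; first exact: xs_harmonic.
  by rewrite mpolyXn -msupp_eq0 msuppX.
move=> W Wsub WH.
have [[w [Ww w0]]|W0] := boolp.pselect (exists w, W w /\ w != 0).
  by right; apply: xs_generates => //; apply: submodule_xs w0.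
by left=> w Ww; apply/eqP/contraT => w0; case: W0; exists w.
Qed.

End Harmonics.

(** * The highest weight *)

Section HighestWeight.
Variables (K : numFieldType) (m : nat) (t : 'I_m.+1) (k : int).
Local Notation n := m.+1.
Local Notation s := (t.+1).
Local Notation lo := (lshift n).
Local Notation hi := (@rshift n n).
Local Notation S := (osc_S n s).
Local Notation P := (@oscP K (n + n) S).
Local Notation xs := ('X_(lo t) ^+ `|k|%N : {mpoly K[n + n]}).
Local Notation rho := (@osc_rep K (n + n) S).
Hypotheses (k0 : k < 0) (tm : (s < m)%N).

Let le_sn : (s <= n)%N := ltn_ord t.

Lemma mderiv_xs j : mderiv j xs
  = (if j == lo t then `|k|%N%:R *: 'X_[U_(lo t) *+ `|k|%N.-1] else 0).
Proof.
rewrite mpolyXn mderivX mulmnE mnm1E eq_sym; case: eqP => [->|_]; last first.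
  by rewrite mul0n scale0r.
rewrite mul1n; congr (_ *: 'X_[_]); apply/mnmP => i.
by rewrite mnmBE !mulmnE mnm1E -[in RHS]subn1 mulnBr muln1.
Qed.

Lemma osc_P_hi_xs i : P (hi i) xs = 0.
Proof. by rewrite /oscP hi_osc_S // mderiv_xs eq_rlshift. Qed.

(** For $i\le s$ the operator $E_{i,i}$ acts as $-x_i\partial_{x_i}-1$: this gives $-1$ before the
    index $s$ and $k-1$ at it. *)
Definition xs_wt (i : nat) : K :=
  if (i < t)%N then -1 else if i == t then (k - 1)%:~R else 0.

Lemma cartan_gen_xs i : rho (cartan_gen K i) xs = xs_wt i *: xs.
Proof.
have -> : cartan_gen K i = so_gen K (lo i) (lo i) by rewrite /so_gen swap_lo.
rewrite osc_rep_so_gen /so_op swap_lo osc_P_hi_xs raddf0 subr0 /xs_wt.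
rewrite /oscP /oscQ lo_osc_S; case: (ltngtP i t) => [it|ti|/val_inj ->].
- rewrite mderivN mderivXM eqxx scale1r mderiv_xs eq_lshift.
  by rewrite -val_eqE ltn_eqF // mulr0 add0r scaleN1r.
- by rewrite mderiv_xs eq_lshift -val_eqE gtn_eqF // mulr0 scale0r.
rewrite mderivN mderivXM eqxx scale1r mderiv_xs eqxx -scalerAr.
rewrite -mpolyXD -mulmS prednK ?absz_gt0 ?lt_eqF // -mpolyXn.
have -> : k - 1 = - (`|k|%N.+1)%:Z by lia.
by rewrite rmorphN /= -pmulrn -natr1 scaleNr scalerDl scale1r.
Qed.

Lemma coroot_xs (j : 'I_n) : rho (coroot K j) xs
  = ((- k)%:~R * (j.+1 == t)%:R + (k - 1)%:~R * (j == t)%:R) *: xs.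
Proof.
rewrite -/(osc_rep_at _ _ _) /coroot; case: ltnP => jm.
  rewrite raddfB /= /osc_rep_at !cartan_gen_xs inordK ?ltnS // -scalerBl.
  congr (_ *: _); rewrite /xs_wt -val_eqE /=.
  case: (ltngtP j.+1 t) => jt.
  - by rewrite (ltn_eqF (ltnW jt)) subrr !mulr0 addr0.
  - by case: eqP => _; rewrite subr0 ?mulr0 ?mulr1 ?add0r.
  rewrite -jt ltn_eqF // mulr1 mulr0 addr0 rmorphN rmorphB /=.
  by ring.
rewrite raddfD /= /osc_rep_at !cartan_gen_xs -scalerDl; congr (_ *: _).
rewrite -val_eqE /=; have -> : j = m :> nat by apply/eqP; rewrite eqn_leq jm
  -ltnS ltn_ord.
rewrite inordK /xs_wt /=; last by rewrite ltnS leq_pred.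
(* Here $s<n-1$ matters: both indices of the last coroot lie beyond $s$, so it acts by 0. *)
have [-> -> ->] : [/\ (m.-1 < t)%N = false, m.-1 == t = false & (m < t)%N =
  false].
  by split; lia.
have [-> ->] : m == t = false /\ m.+1 == t = false by split; lia.
by rewrite !mulr0 addr0.
Qed.

(** Dimension count: the coroots are $n$ independent vectors in a space spanned by $n$ vectors. *)
Lemma cartan_coroot_span : (cartan K n <= <<[tuple coroot K j | j < n]>>)%VS.
Proof.
have cartanE : cartan K n = <<[tuple cartan_gen K j | j < n]>>%VS.
  by rewrite span_def big_tuple; apply: eq_bigr => i _; rewrite tnth_mktuple.
have gen_in i : cartan_gen K i \in cartan K n.
  by rewrite cartanE memv_span //; apply/mapP; exists i; rewrite ?mem_enum.
have sub : (<<[tuple coroot K j | j < n]>> <= cartan K n)%VS.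
  apply/span_subvP => _ /mapP[j _ ->]; rewrite /coroot.
  by case: ifP => _; [apply: memvB|apply: memvD].
have m0 : (0 < m)%N by apply: leq_ltn_trans tm.
have := coroot_free K m0; rewrite /free size_tuple => /eqP dimn.
by rewrite -(dimv_leqif_sup sub) eqn_leq dimvS //= dimn cartanE (leq_trans
  (dim_span _)) ?size_tuple.
Qed.

Lemma cartan_xs X : X \in cartan K n -> rho X xs
  = ((- k)%:~R * fund_weight s.-1 X + (k - 1)%:~R * fund_weight s X) *: xs.
Proof.
move/(subvP cartan_coroot_span)/coord_span => XE.
rewrite {1}XE -/(osc_rep_at _ _ _) linear_sum /=.
under eq_bigr => j _ do rewrite linearZ /= (nth_map j) ?size_enum_ord //
  nth_ord_enum /osc_rep_at coroot_xs scalerA.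
rewrite -scaler_suml; congr (_ *: _).
under eq_bigr => j _ do rewrite mulrDr; rewrite big_split; congr (_ + _).
  (* For $s=1$ the first weight is $\lambda_0=0$, and no [j] has [j.+1] equal to 0. *)
  case et : (t : nat) => [|t'] /=.
    by rewrite mulr0 big1 // => j _; rewrite /= !mulr0.
  rewrite (bigD1 (inord t')) //= big1 ?addr0 => [|j].
    by rewrite inordK ?eqxx ?mulr1 1?mulrC //; lia.
  by rewrite -val_eqE /= inordK ?eqSS => [/negPf->|]; rewrite ?mulr0 //; lia.
rewrite /fund_weight inord_val (bigD1 t) //= eqxx mulr1 mulrC big1 ?addr0 // =>
  j.
by move=> /negPf ->; rewrite !mulr0.
Qed.

(** Every $P_{n+i}$ kills $x_s^{-k}$, which leaves $Q_iP_b$ with $i<b\le n$. If $b>s$ then $P_b$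
    kills it; otherwise $i<s$, and $\partial_{x_i}$ kills $x_bx_s^{-k}$. *)
Lemma pos_xs X : X \in so_even_pos K n -> rho X xs = 0.
Proof.
have gen0 (i : 'I_n) (j : 'I_(n + n)) :
    (forall b : 'I_n, j = lo b -> (i < b)%N) -> osc_rep_at S xs (so_gen K (lo
      i) j) = 0.
  move=> ij; rewrite /osc_rep_at osc_rep_so_gen /so_op swap_lo osc_P_hi_xs
    raddf0 subr0.
  case: (split_ordP j) => b jE; last by rewrite jE osc_P_hi_xs raddf0.
  have ib := ij b jE; rewrite jE /oscP lo_osc_S; case: leqP => sb; last first.
    by rewrite mderiv_xs eq_lshift -val_eqE gtn_eqF // raddf0.
  rewrite /oscQ lo_osc_S leqNgt (leq_trans ib (leqW sb)) /= mderivN mderivXM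
    mderiv_xs.
  rewrite !eq_lshift -!val_eqE !ltn_eqF //= ?mulr0 ?scale0r ?addr0 ?oppr0 //.
  exact: leq_trans ib sb.
rewrite -/(osc_rep_at S xs X) => /memv_sumP[Y YP ->]; rewrite linear_sum big1
  // => i _.
have [Z ZP ->] := memv_sumP (YP i isT); rewrite linear_sum big1 // => j ij.
have /memv_addP[Z1 /vlineP[c1 ->] [Z2 /vlineP[c2 ->] ->]] := ZP j ij.
rewrite linearD !linearZ /=.
have := gen0 i (lo j); rewrite /so_gen !swap_lo => ->; last first.
  by move=> b /eqP; rewrite eq_lshift => /eqP <-.
have := gen0 i (hi j); rewrite /so_gen swap_lo swap_hi => ->; last first.
  by move=> b /eqP; rewrite eq_rlshift.
by rewrite !scaler0 addr0.
Qed.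

End HighestWeight.

(** * The basis *)

Section HarmonicBasis.
Variables (K : numFieldType) (m s : nat) (k : int).
Local Notation n := m.+1.
Local Notation lo := (lshift n).
Local Notation hi := (@rshift n n).
Local Notation S := (osc_S n s).
Local Notation P := (@oscP K (n + n) S).
Local Notation H := (@harmonic_part K n s k).
Local Notation w := (widen_ord (leqnSn m)).
Local Notation top := (@ord_max m).
Implicit Types (a c : 'X_{1..n + n}) (r : {ffun 'I_m -> nat})
  (i : 'I_m).
Hypothesis le_sm : (s <= m)%N.

Let le_sn : (s <= n)%N := leqW le_sm.

Definition widen_ffun r (i : 'I_n) : nat := if insub (val i) is Some j then r j
  else 0.

Definition basis_exp a r : 'X_{1..n + n} := [multinom
  match split j with
  | inl i => if i == top then a (lo i) + \sum_(i < m) r i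
             else if (i < s)%N then a (lo i) + widen_ffun r i
             else a (lo i) - widen_ffun r i
  | inr i => if i == top then a (hi i) + \sum_(i < m) r i
             else a (hi i) - widen_ffun r i
  end%N | j < n + n].

Lemma widen_top (i : 'I_m) : (w i == top) = false.
Proof. by rewrite -val_eqE /= ltn_eqF. Qed.

Lemma widen_ffunE r (i : 'I_m) : widen_ffun r (w i) = r i.
Proof. by rewrite /widen_ffun /= valK. Qed.

Lemma basis_exp_lo a r (i : 'I_m) : basis_exp a r (lo (w i))
  = (if (s <= i)%N then a (lo (w i)) - r i else a (lo (w i)) + r i)%N.
Proof.
rewrite mnmE (unsplitK (inl _)) widen_top widen_ffunE /= ltnNge.
by case: leqP.
Qed.

Lemma basis_exp_hi a r (i : 'I_m) :
  basis_exp a r (hi (w i)) = (a (hi (w i)) - r i)%N.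
Proof. by rewrite mnmE (unsplitK (inr _)) widen_top widen_ffunE. Qed.

Lemma basis_exp_lo_top a r :
  basis_exp a r (lo top) = (a (lo top) + \sum_(i < m) r i)%N.
Proof. by rewrite mnmE (unsplitK (inl _)) eqxx. Qed.

Lemma basis_exp_hi_top a r :
  basis_exp a r (hi top) = (a (hi top) + \sum_(i < m) r i)%N.
Proof. by rewrite mnmE (unsplitK (inr _)) eqxx. Qed.

Definition basis_expE :=
  (basis_exp_lo, basis_exp_hi, basis_exp_lo_top, basis_exp_hi_top).

Lemma mnm_halfP a c :
  (forall i : 'I_m, a (lo (w i)) = c (lo (w i))) ->
  (forall i : 'I_m, a (hi (w i)) = c (hi (w i))) ->
  a (lo top) = c (lo top) -> a (hi top) = c (hi top) -> a = c.
Proof.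
move=> alo ahi tlo thi; apply/mnmP => j.
have cs (i : 'I_n) : i = top \/ exists i', i = w i'.
  case: (unliftP top i) => [i'|] ->; last by left.
  by right; exists i'; apply: val_inj; rewrite /= /bump leqNgt ltn_ord.
by case: (split_ordP j) => i ->; case: (cs i) => [->|[i' ->]].
Qed.

Lemma basis_monomE a r : basis_monom K s a r = 'X_[basis_exp a r].
Proof.
rewrite mpolyXE_id big_split_ord /= !big_ord_recr /= /basis_monom !basis_expE.
under [X in _ = _ * (X * _)]eq_bigr => i _ do rewrite basis_exp_hi.
under [X in _ = (X * _) * _]eq_bigr => i _ do rewrite basis_exp_lo.
rewrite [X in _ = (X * _) * _](bigID (fun i : 'I_m => (i < s)%N)) /=.
have -> : \prod_(i < m | (i < s)%N) 'X_(lo (w i)) ^+ (a (lo (w i)) + r i)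
    = \prod_(i < m | (i < s)%N) 'X_(lo (w i)) ^+
        (if (s <= i)%N then a (lo (w i)) - r i else a (lo (w i)) + r i)%N
    :> {mpoly K[n + n]}.
  by apply: eq_bigr => i; rewrite ltnNge => /negPf ->.
have -> : \prod_(i < m | (s <= i)%N) 'X_(lo (w i)) ^+ (a (lo (w i)) - r i)
    = \prod_(i < m | ~~ (i < s)%N) 'X_(lo (w i)) ^+
        (if (s <= i)%N then a (lo (w i)) - r i else a (lo (w i)) + r i)%N
    :> {mpoly K[n + n]}.
  by apply: eq_big => [i|i ->]; rewrite -?leqNgt.
by ring.
Qed.

(** The part of the coefficient that depends on $r_i$ alone; the rest depends only on $|r|$. *)
Definition basis_factor a (i : 'I_m) (x : nat) : K :=
  if (s <= i)%N
  then (-1) ^+ x * ('C(a (lo (w i)), x) * 'C(a (hi (w i)), x) * x`!)%:R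
  else 'C(a (hi (w i)), x)%:R.

Lemma basis_coefE a r : let rs := (\sum_(i < m) r i)%N in
  basis_coef K s a r = \prod_(i < m) basis_factor a i (r i)
    * ((a (lo top))`! * (a (hi top))`! * rs`!)%:R
    / ((a (lo top) + rs)`! * (a (hi top) + rs)`!)%:R.
Proof.
move=> rs; rewrite /basis_coef -/rs; congr (_ / _).
have -> : \prod_(i < m) basis_factor a i (r i)
    = (-1) ^+ (\sum_(j < m | (s <= j)%N) r j)
      * ((\prod_(j < m | (s <= j)%N) 'C(a (lo (w j)), r j))
         * (\prod_(i < m) 'C(a (hi (w i)), r i))
         * \prod_(j < m | (s <= j)%N) (r j)`!)%:R.
  rewrite !natrM -prodrXr !natr_prod !(big_mkcond (fun j : 'I_m => s <= j)%N)
    /=.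
  rewrite -!big_split; apply: eq_bigr => i _ /=; rewrite /basis_factor.
  by case: ifP => _; rewrite ?natrM ?mulr1 ?mul1r // !mulrA.
by rewrite !natrM; ring.
Qed.

Definition ffun_incr r (i : 'I_m) : {ffun 'I_m -> nat} :=
  [ffun j => if j == i then (r j).+1 else r j].

Lemma sum_incr r i : (\sum_(j < m) ffun_incr r i j = (\sum_(j < m) r j).+1)%N.
Proof.
rewrite (bigD1 i) //= [in RHS](bigD1 i) //= ffunE eqxx addSn.
by congr (_ + _).+1; apply: eq_bigr => j /negPf ne; rewrite ffunE ne.
Qed.

(** Follows from $(x+1)\binom{b}{x+1}=(b-x)\binom{b}{x}$, which holds with truncated subtraction
    too. *)
Lemma basis_factor_incr a i x : basis_factor a i x.+1 * x.+1%:R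
  = - basis_factor a i x
    * (if (s <= i)%N then ((a (lo (w i)) - x) * (a (hi (w i)) - x))%:R
       else - (a (hi (w i)) - x)%:R).
Proof.
have binE b : 'C(b, x.+1)%:R * x.+1%:R = 'C(b, x)%:R * (b - x)%:R :> K.
  by rewrite -!natrM mulnC mul_bin_left mulnC.
rewrite /basis_factor; case: ifP => _; last by rewrite binE mulrNN.
rewrite factS !natrM.
transitivity ((-1) ^+ x.+1 * ('C(a (lo (w i)), x.+1)%:R * x.+1%:R)
   * ('C(a (hi (w i)), x.+1)%:R * x.+1%:R) * x`!%:R : K); first by ring.
by rewrite !binE exprS; ring.
Qed.

Lemma basis_coef_incr a r i : let rs := (\sum_(j < m) r j)%N in
  basis_coef K s a r * (rs.+1)%:R
    * (if (s <= i)%N then ((a (lo (w i)) - r i) * (a (hi (w i)) - r i))%:R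
       else - (a (hi (w i)) - r i)%:R)
  = - (r i).+1%:R * ((a (lo top) + rs).+1 * (a (hi top) + rs).+1)%:R
    * basis_coef K s a (ffun_incr r i).
Proof.
move=> rs; rewrite !basis_coefE sum_incr -/rs (addnS (a (lo top))) (addnS (a
  (hi top))) !factS.
rewrite (bigD1 i) //= [in RHS](bigD1 i) //= ffunE eqxx.
have -> : \prod_(j < m | j != i) basis_factor a j (ffun_incr r i j)
    = \prod_(j < m | j != i) basis_factor a j (r j).
  by apply: eq_bigr => j /negPf ne; rewrite ffunE ne.
set p := \prod_(j < m | _) _; have := basis_factor_incr a i (r i).
set D := (if _ then _ else _); move=> eD.
rewrite !natrM.
set u := (a (lo top) + rs)%N; set v := (a (hi top) + rs)%N.
have nz x : (x`!)%:R != 0 :> K by rewrite pnatr_eq0 -lt0n fact_gt0.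
have nzS x : x.+1%:R != 0 :> K by rewrite pnatr_eq0.
transitivity (p * (a (lo top))`!%:R * (a (hi top))`!%:R * rs.+1%:R * rs`!%:R
    / (u`!%:R * v`!%:R) * - (- basis_factor a i (r i) * D) : K).
  by field; rewrite !nz.
rewrite -eD; move: (nzS u) (nzS v).
move: (u.+1%:R : K) (v.+1%:R : K) => U V U0 V0.
by field; rewrite !nz U0 V0.
Qed.

Definition basis_term a r : {mpoly K[n + n]} :=
  basis_coef K s a r *: 'X_[basis_exp a r].

Lemma basis_term_eq0 a r i : (a (hi (w i)) < r i)%N -> basis_term a r = 0.
Proof.
by move=> ar; rewrite /basis_term (basis_coef_eq0 _ _ ar) scale0r.
Qed.

(** Both sides are multiples of the same monomial [E], and [basis_coef_incr] compares the
    scalars. *)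
Lemma basis_term_incr a r i : let rs := (\sum_(j < m) r j)%N in
  rs.+1%:R *: P (lo (w i)) (P (hi (w i)) (basis_term a r))
  = - (r i).+1%:R *: mderiv (lo top) (mderiv (hi top) (basis_term a (ffun_incr
    r i))).
Proof.
move=> rs; set E := (basis_exp a (ffun_incr r i) - U_(hi top) - U_(lo top))%MM.
have wE j : (w i == w j) = (i == j) by rewrite -!val_eqE.
have expE : E = (if (s <= i)%N then basis_exp a r - U_(hi (w i)) - U_(lo (w i))
       else U_(lo (w i)) + (basis_exp a r - U_(hi (w i))))%MM.
  have ew j : (top == w j) = false by rewrite eq_sym widen_top.
  apply: mnm_halfP => [j|j||]; rewrite mnmBE mnmBE !mnm1E.
  - rewrite eq_lshift eq_rlshift ew !subn0 basis_exp_lo ffunE [j == i]eq_sym.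
    case si: (s <= i)%N; rewrite ?mnmDE mnmBE ?mnmBE !mnm1E eq_lshift
      eq_rlshift;
      rewrite wE subn0 basis_exp_lo.
      by case: (i =P j) => [<-|_]; rewrite ?si ?subn0 // subnS subn1.
    by case: (i =P j) => [<-|_]; rewrite ?si // addnS.
  - rewrite eq_lrshift eq_rshift ew !subn0 basis_exp_hi ffunE [j == i]eq_sym.
    case si: (s <= i)%N; rewrite ?mnmDE mnmBE ?mnmBE !mnm1E eq_lrshift
      eq_rshift;
      rewrite wE ?subn0 ?add0n basis_exp_hi.
      by case: (i =P j) => [<-|_]; rewrite ?subn0 // subnS subn1.
    by case: (i =P j) => [<-|_]; rewrite ?subn0 // subnS subn1.
  - rewrite eq_lshift eq_rlshift eqxx subn0 basis_exp_lo_top sum_incr.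
    rewrite (addnS (a (lo top))) subn1 /=.
    by case si: (s <= i)%N; rewrite ?mnmDE mnmBE ?mnmBE !mnm1E eq_lshift
      eq_rlshift;
      rewrite widen_top ?subn0 ?add0n basis_exp_lo_top.
  - rewrite eq_lrshift eq_rshift eqxx subn0 basis_exp_hi_top sum_incr.
    rewrite (addnS (a (hi top))) subn1 /=.
    by case si: (s <= i)%N; rewrite ?mnmDE mnmBE ?mnmBE !mnm1E eq_lrshift
      eq_rshift;
      rewrite widen_top ?subn0 ?add0n basis_exp_hi_top.
have -> : P (lo (w i)) (P (hi (w i)) (basis_term a r)) = (basis_coef K s a r
    * (if (s <= i)%N then ((a (lo (w i)) - r i) * (a (hi (w i)) - r i))%:R
       else - (a (hi (w i)) - r i)%:R)) *: 'X_[E].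
  rewrite /basis_term !linearZ /= -scalerA; congr (_ *: _).
  rewrite /oscP hi_osc_S // mderivX linearZ /= basis_exp_hi expE lo_osc_S /=.
  case: ifP => si; last by rewrite scaleNr -scalerAr mpolyXD.
  rewrite mderivX scalerA -natrM mnmBE mnm1E eq_rlshift subn0 basis_exp_lo si.
  by rewrite mulnC.
rewrite /basis_term !mderivZ mderivX mderivZ mderivX -/E.
rewrite mnmBE mnm1E eq_rlshift subn0 !basis_expE sum_incr -/rs.
rewrite (addnS (a (lo top))) (addnS (a (hi top))) !scalerA; congr (_ *: _).
rewrite mulrA [_%:R * basis_coef _ _ _ _]mulrC basis_coef_incr -/rs natrM.
by ring.
Qed.

Definition ffun_val B (q : {ffun 'I_m -> 'I_B}) : {ffun 'I_m -> nat} :=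
  [ffun i => q i : nat].

(** Outside the box some binomial coefficient vanishes, so a finite sum suffices. *)
Lemma basis_polyE a B : (forall i : 'I_m, a (hi (w i)) < B)%N ->
  basis_poly K s a = \sum_(q : {ffun 'I_m -> 'I_B}) basis_term a (ffun_val q).
Proof.
move=> aB; rewrite /basis_poly.
have inj_val : injective (@ffun_val B).
  move=> q q' /ffunP eq; apply/ffunP => i; apply: val_inj.
  by have := eq i; rewrite !ffunE.
rewrite (@fsbigE _ _ _ _ _ [seq ffun_val q | q <- enum {ffun 'I_m -> 'I_B}]) //.
- rewrite big_map big_enum_cond /=; apply: eq_big => [q|q _]; last first.
    by rewrite basis_monomE.
  by rewrite in_setT.
- by rewrite map_inj_uniq ?enum_uniq.
move=> r _ rn; case: (pickP [pred i | (B <= r i)%N]) => [i /= Bi | rB].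
  by rewrite basis_monomE; apply: (@basis_term_eq0 a r i); apply: leq_trans Bi.
case/negP: rn; apply/mapP.
have rB' i : (r i < B)%N by have := rB i; rewrite /= leqNgt => /negbFE.
exists [ffun i => Ordinal (rB' i)]; first by rewrite mem_enum.
by apply/ffunP => i; rewrite !ffunE.
Qed.

Lemma basis_poly_Delta a : (a (lo top) * a (hi top) = 0)%N ->
  osc_Delta s (basis_poly K s a) = 0.
Proof.
move=> a0; pose b := (\sum_(i < m) a (hi (w i)))%N.
have aB (i : 'I_m) : (a (hi (w i)) < b.+1)%N.
  by rewrite ltnS /b (bigD1 i) //= leq_addr.
rewrite (basis_polyE aB) linear_sum /=.
pose dd f : {mpoly K[n + n]} := mderiv (lo top) (mderiv (hi top) f).
pose rsum (r : {ffun 'I_m -> nat}) := (\sum_(j < m) r j)%N.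
(* The share of index [i] in the term under $\partial_{x_n}\partial_{x_{2n}}$; at $r=0$ all shares
   are 0. *)
pose g i r : {mpoly K[n + n]} := ((r i)%:R / (rsum r)%:R) *: dd (basis_term a
  r).
have DeltaE r : osc_Delta s (basis_term a r)
    = dd (basis_term a r) - \sum_(i < m) g i (ffun_incr r i).
  rewrite osc_DeltaE // big_ord_recr /= addrC -sumrN; congr (_ + _).
    by rewrite /oscP hi_osc_S // lo_osc_S le_sm.
  apply: eq_bigr => i _; rewrite /g ffunE eqxx /rsum sum_incr.
  have rs0 : (\sum_(j < m) r j)%N.+1%:R != 0 :> K by rewrite pnatr_eq0.
  apply: (scalerI rs0); rewrite basis_term_incr scalerN scalerA mulrCA divff //.
  by rewrite mulr1 scaleNr.
under eq_bigr => q _ do rewrite DeltaE.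
rewrite sumrB exchange_big /=.
have shift i : \sum_(q : {ffun 'I_m -> 'I_b.+1}) g i (ffun_incr (ffun_val q) i)
    = \sum_(q : {ffun 'I_m -> 'I_b.+1}) g i (ffun_val q).
  (* The cyclic successor permutes the box. At the wrap-around both sides vanish: on the left
     $r_i=b+1$ exceeds the exponent, on the right $r_i=0$ makes the share zero. *)
  pose sh (q : {ffun 'I_m -> 'I_b.+1}) : {ffun 'I_m -> 'I_b.+1} :=
    [ffun j => if j == i then ordS (q j) else q j].
  have sh_inj : injective sh.
    move=> q q' /ffunP eq; apply/ffunP => j; have := eq j; rewrite !ffunE.
    by case: eqP => // _; apply: ordS_inj.
  rewrite [RHS](reindex_inj sh_inj) /=; apply: eq_bigr => q _.
  have [qb|qb] := ltnP (q i).+1 b.+1.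
    congr (g i _); apply/ffunP => j; rewrite !ffunE; case: eqP => // -> /=.
    by rewrite modn_small.
  have qE : (q i).+1 = b.+1 by apply/eqP; rewrite eqn_leq qb ltn_ord.
  rewrite /g (@basis_term_eq0 a _ i); last by rewrite !ffunE eqxx qE aB.
  rewrite {1}/dd !mderiv0 scaler0 [ffun_val (sh q) i]ffunE ffunE eqxx /= qE
    modnn.
  by rewrite mul0r scale0r.
under [X in _ - X]eq_bigr => i _ do rewrite shift.
rewrite exchange_big -sumrB big1 // => q _; set r := ffun_val q.
rewrite /g -scaler_suml -mulr_suml -natr_sum -/(rsum r).
(* For $|r|>0$ the shares add up to the whole term; for $r=0$ the term is killed because
   $\alpha_n\alpha_{2n}=0$. *)
have [r0|r0] := eqVneq (rsum r) 0%N; last by rewrite divff ?pnatr_eq0 //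
  scale1r subrr.
rewrite r0 mul0r scale0r subr0 /dd /basis_term !mderivZ mderivX !mderivZ
  mderivX.
rewrite mnmBE mnm1E eq_rlshift subn0 !basis_expE -/(rsum r) r0 !addn0.
rewrite [X in _ *: X]scalerA -natrM mulnC a0 scale0r scaler0.
by [].
Qed.

(** A term with $r\ne0$ contains both $x_n$ and $x_{2n}$, so only $r=0$ contributes, with
    coefficient 1. *)
Lemma basis_poly_mcoeff a c : (c (lo top) * c (hi top) = 0)%N ->
  (basis_poly K s a)@_c = (a == c)%:R.
Proof.
move=> c0; pose b := (\sum_(i < m) a (hi (w i)))%N.
have aB (i : 'I_m) : (a (hi (w i)) < b.+1)%N.
  by rewrite ltnS /b (bigD1 i) //= leq_addr.
rewrite (basis_polyE aB) raddf_sum /=.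
under eq_bigr do rewrite mcoeffZ mcoeffX.
pose q0 : {ffun 'I_m -> 'I_b.+1} := [ffun => ord0].
have exp_c q : basis_exp a (ffun_val q) = c -> q = q0.
  move=> ec; have : (\sum_(i < m) ffun_val q i = 0)%N.
    move: c0; rewrite -ec !basis_expE => /eqP; rewrite muln_eq0 !addn_eq0.
    by case/orP => /andP[_ /eqP].
  move/eqP; rewrite sum_nat_eq0 => /forallP qi; apply/ffunP => i.
  by apply: val_inj; have := qi i; rewrite !ffunE /= => /eqP.
have sum0 : (\sum_(i < m) ffun_val q0 i = 0)%N by rewrite big1 // => i _;
  rewrite !ffunE.
have exp0 : basis_exp a (ffun_val q0) = a.
  apply: mnm_halfP => [i|i||]; rewrite basis_expE ?sum0 ?addn0 // !ffunE ?subn0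
    //.
  by rewrite addn0 if_same.
rewrite (bigD1 q0) //= big1 => [|q /eqP qq0]; last first.
  by case: eqP => [/exp_c //|]; rewrite mulr0.
rewrite exp0 addr0 basis_coefE sum0 !addn0 fact0 muln1 -mulrA divff.
  rewrite mulr1 big1 ?mul1r // => i _.
  by rewrite /basis_factor !ffunE !bin0 expr0 mul1r if_same.
by rewrite pnatr_eq0 muln_eq0 negb_or -!lt0n !fact_gt0.
Qed.

(** A nonzero coefficient bounds each $r_i$ by the exponents, so no subtraction truncates; each
    $r_i$ then costs degree $2r_i$, and the last pair restores $2|r|$. *)
Lemma basis_poly_graded a : osc_deg S a = k -> graded_part S k (basis_poly K s
  a).
Proof.
move=> ak; pose b := (\sum_(i < m) a (hi (w i)))%N.
have aB (i : 'I_m) : (a (hi (w i)) < b.+1)%N.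
  by rewrite ltnS /b (bigD1 i) //= leq_addr.
rewrite (basis_polyE aB); apply: graded_part_sum => q _; set r := ffun_val q.
apply/graded_partP => c; rewrite /basis_term mcoeffZ mcoeffX mulf_eq0 negb_or.
rewrite pnatr_eq0 eqb0 negbK => /andP[cf /eqP <-]; rewrite -ak.
have fac i : basis_factor a i (r i) != 0.
  move: cf; rewrite basis_coefE !mulf_eq0 !negb_or -!andbA => /andP[+ _].
  by move/prodf_neq0; apply.
have r_hi i : (r i <= a (hi (w i)))%N.
  rewrite leqNgt; apply: contra (fac i) => lt_ar; rewrite /basis_factor
    (bin_small lt_ar).
  by rewrite muln0 mul0n mulr0 if_same.
have r_lo (i : 'I_m) : (s <= i)%N -> (r i <= a (lo (w i)))%N.
  move=> si; rewrite leqNgt; apply: contra (fac i) => lt_ar.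
  by rewrite /basis_factor si (bin_small lt_ar) !mul0n mulr0.
rewrite !osc_deg_half // !big_ord_recr /= le_sm !basis_expE.
rewrite !PoszD.
have -> : \sum_(i < m) ((if (s <= i)%N then (basis_exp a r (lo (w i)))%:Z
      else - (basis_exp a r (lo (w i)))%:Z) + (basis_exp a r (hi (w i)))%:Z)
    = \sum_(i < m) ((if (s <= i)%N then (a (lo (w i)))%:Z
      else - (a (lo (w i)))%:Z) + (a (hi (w i)))%:Z) - 2 * (\sum_(i < m) r
        i)%N%:Z.
  rewrite [X in _ = _ - 2 * X](big_morph Posz PoszD (erefl _)) mulr_sumr -sumrB.
  apply: eq_bigr => i _; rewrite basis_exp_lo basis_exp_hi.
  have := r_hi i; case si: (s <= i)%N; last by lia.
  by have := r_lo i si; lia.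
by ring.
Qed.

(** Reading $\Delta f=0$ at $x^c/(x_nx_{2n})$ expresses a nonzero multiple of the coefficient at [c]
    through coefficients with a smaller power of $x_n$. *)
Lemma harmonic_eq0 (f : {mpoly K[n + n]}) : osc_Delta s f = 0 ->
  (forall c, (c (lo top) * c (hi top) = 0)%N -> f@_c = 0) -> f = 0.
Proof.
move=> Df f0.
suff fc d c : (c (lo top) < d)%N -> f@_c = 0.
  by apply/mpolyP => c; rewrite mcoeff0; apply: (fc (c (lo top)).+1).
elim: d c => // d IH c; rewrite ltnS => cd.
have [c0|] := eqVneq (c (lo top) * c (hi top))%N 0%N; first exact: f0.
rewrite muln_eq0 negb_or => /andP[c1 c2].
have [c' cE] : exists c', c = (c' + U_(lo top) + U_(hi top))%MM.
  exists (c - (U_(lo top) + U_(hi top)))%MM; rewrite -addmA submK //.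
  apply/mnm_lepP => j; rewrite mnmDE !mnm1E.
  case: eqP => [<-|_]; first by rewrite eq_rlshift addn0 lt0n.
  by case: eqP => [<-|_] //; rewrite lt0n.
have c'd : (c' (lo top) < d)%N.
  by apply: leq_trans cd; rewrite cE !mnmDE !mnm1E eqxx; lia.
have := congr1 (mcoeff c') Df; rewrite osc_DeltaE // mcoeff0 big_ord_recr /=.
rewrite mcoeffD raddf_sum /= big1 ?add0r => [|i _].
  rewrite /oscP hi_osc_S // lo_osc_S le_sm !mcoeff_deriv -cE.
  by move/eqP; rewrite !mulrn_eq0 /= => /eqP.
rewrite /oscP hi_osc_S // lo_osc_S; case: ifP => si.
  rewrite !mcoeff_deriv IH ?mul0rn // !mnmDE !mnm1E eq_rlshift eq_lshift.
  by rewrite widen_top !addn0.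
rewrite mcoeffN mcoeff_XM; case: ifP => [_|_]; rewrite ?oppr0 //.
rewrite mcoeff_deriv IH ?mul0rn ?oppr0 // mnmDE mnmBE !mnm1E eq_rlshift addn0.
by rewrite eq_lshift widen_top subn0.
Qed.

Lemma basis_indexE a : basis_index s k a
  <-> (a (lo top) * a (hi top) = 0)%N /\ osc_deg S a = k.
Proof.
rewrite /basis_index osc_deg_half // big_split /=.
rewrite [X in _ <-> _ /\ X + _ = _](bigID (fun j : 'I_n => s <= j)%N) /=.
suff -> : \sum_(j < n | (s <= j)%N) (a (lo j))%:Z + \sum_(i < n) (a (hi i))%:Z
    - \sum_(i < n | (i < s)%N) (a (lo i))%:Z
  = \sum_(j < n | (s <= j)%N) (if (s <= j)%N then (a (lo j))%:Z else - (a (lo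
    j))%:Z)
    + \sum_(j < n | ~~ (s <= j)%N) (if (s <= j)%N then (a (lo j))%:Z else - (a
      (lo j))%:Z)
    + \sum_(i < n) (a (hi i))%:Z by [].
rewrite addrAC -sumrN; congr (_ + _ + _); first by apply: eq_bigr => i ->.
by apply: eq_big => [i|i]; [rewrite -ltnNge|rewrite ltnNge => /negPf ->].
Qed.

(** Coefficients at monomials with $\alpha_n\alpha_{2n}=0$ are dual to the family, which gives
    independence; they also determine a harmonic polynomial, which gives the expansion. *)
Lemma harmonic_basis : is_basis_of (basis_index s k) (@basis_poly K m s) H.
Proof.
have bH a : basis_index s k a -> H (basis_poly K s a).
  by move=> /basis_indexE[a0 ak]; split; [exact: basis_poly_graded|exact:
    basis_poly_Delta].
split=> [r c ur rP sum0 a ar | f].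
  have /basis_indexE[a0 _] := rP a ar.
  have := congr1 (mcoeff a) sum0; rewrite raddf_sum /= mcoeff0 (bigD1_seq a)
    //=.
  rewrite mcoeffZ basis_poly_mcoeff // eqxx mulr1 big1 ?addr0 // => b /negPf ba.
  by rewrite mcoeffZ basis_poly_mcoeff // ba mulr0.
split=> [[fk f0]|[r rP ->]]; last first.
  rewrite big_seq; elim/big_ind: _ => [|u v [uk u0] [vk v0]|p pr].
  - by split; [exact: graded_part0|rewrite raddf0].
  - by split; [exact: graded_partD|rewrite raddfD /= u0 v0 addr0].
  have [a /bH[ak a0] ->] := rP p pr.
  by split; [exact: graded_partZ|rewrite linearZ /= a0 scaler0].
pose A := [seq a : 'X_{1..n + n} <- msupp f | (a (lo top) * a (hi top) == 0)%N].
have AP a : a \in A -> basis_index s k a.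
  rewrite mem_filter mcoeff_msupp => /andP[/eqP a0 fa]; apply/basis_indexE.
  by split=> //; have /graded_partP := fk; apply.
exists [seq (f@_a, basis_poly K s a) | a <- A].
  by move=> _ /mapP[a /AP aA ->]; exists a.
apply/eqP; rewrite big_map -subr_eq0; apply/eqP; apply: harmonic_eq0.
  rewrite raddfB /= f0 sub0r linear_sum /= big_seq big1 ?oppr0 // => a aA.
  by rewrite linearZ /= (bH a (AP a aA)).2 scaler0.
move=> c c0; rewrite mcoeffB raddf_sum /=.
under eq_bigr do rewrite mcoeffZ basis_poly_mcoeff //.
have [cA|cA] := boolP (c \in A).
  rewrite (bigD1_seq c) ?filter_uniq ?msupp_uniq //= eqxx mulr1 big1 ?addr0
    ?subrr //.
  by move=> b /negPf ->; rewrite mulr0.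
rewrite big_seq big1 ?subr0 => [|b bA].
  by move: cA; rewrite mem_filter c0 eqxx /= => /memN_msupp_eq0.
by case: eqP => [bc|]; rewrite ?mulr0 //; rewrite -bc bA in cA.
Qed.

End HarmonicBasis.

(** * Assembly over the complex numbers *)

Local Open Scope complex_scope.

(* The rank is n = m + 1. *)
Theorem theorem3p5 (R : realType) (m s : nat) (k : int)
    (hs : (1 <= s)%N) (hsn : (s < m.+1 - 1)%N)
    (hk : k <= - (m.+1%:Z - s%:Z - 1)) :
  let S := osc_S m.+1 s in
  let A := @graded_part R[i] _ S in
  let H := @harmonic_part R[i] m.+1 s in
  let G := so_even R[i] m.+1 in
  let rho := @osc_rep R[i] _ S in
  let mu := fun X : 'M[R[i]]_(m.+1 + m.+1) =>
    (- k)%:~R * fund_weight s.-1 X + (k - 1)%:~R * fund_weight s X in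
  let xs : {mpoly R[i][m.+1 + m.+1]} := 'X_(lshift m.+1 (inord s.-1)) in
  [/\ is_direct_sum (A k) (H k) (fun f => exists2 g, A (k - 2) g & f = osc_eta s g),
      irreducible_module rho G (H k),
      highest_weight_module rho G (cartan R[i] m.+1) (so_even_pos R[i] m.+1)
        mu (xs ^+ `|k|%N) (H k) &
      is_basis_of (basis_index s k) (@basis_poly R[i] m s) (H k)].
Proof.
have sm : (s < m)%N by rewrite subn1 in hsn.
(* From $s<n-1$ the bound on [k] is at most $-1$. *)
have k0 : k < 0 by lia.
(* The 0-based index of $x_s$; replacing [s] by [t.+1] matches the form of the lemmas. *)
pose t : 'I_m.+1 := inord s.-1.
have ts : t.+1 = s by rewrite /t inordK ?prednK //; lia.
move=> S A H G rho mu xs; rewrite /xs /mu -/t {xs mu}.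
rewrite {}/H {}/rho {}/A {}/S; clearbody t; subst s.
have nz : 'X_(lshift m.+1 t) ^+ `|k|%N != 0 :> {mpoly R[i][m.+1 + m.+1]}.
  by rewrite mpolyXn -msupp_eq0 msuppX.
split; first exact: harmonic_decomposition.
- exact: harmonic_irreducible.
- split; [exact: harmonic_submodule|exact: xs_harmonic| |exact: xs_generates].
  by split; [|exact: cartan_xs|exact: pos_xs].
- exact: harmonic_basis (ltnW sm).
Qed.
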